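(* (I) Let $n \ge 2$ and let $A$ be an $n\times n$ random matrix with independent columns such that, for each of the first $n-1$ columns, the entries of that column are iid with an absolutely continuous distribution. Let $PA = LU$ be the factorization obtained by Gaussian elimination with partial pivoting (GEPP) applied to $A$. Then $P \sim \operatorname{Uniform}(\mathcal P_n)$, and $\Pi(A) \sim n - \Upsilon_n$. (II) Let $N = 2^m$ with $m \ge 1$ and let $B \sim \operatorname{B}_s(N,\Sigma_S)$ be a Haar-butterfly matrix. Let $PB = LU$ be the GEPP factorization of $B$. Then $P \sim \operatorname{Uniform}(\mathcal P_N^{(B)})$, and $\Pi(B) \sim \frac{N}{2}\operatorname{Bernoulli}\left(1-\frac1N\right)$.
   Context: $X\sim Y$ means equality in distribution. $\mathbb F$ is $\mathbb R$ or $\mathbb C$. A random variable is called (absolutely) continuous if its law is absolutely continuous with respect to Lebesgue measure (on $\mathbb R$ for real variables, on $\mathbb C$ for complex variables). $\operatorname{Bernoulli}(p)$ is the law of $\xi\in\{0,1\}$ with $\mathbb P(\xi=1)=p$. GEPP: for an $n\times n$ matrix $A$ over $\mathbb F$, put $A^{(1)}=A$. At step $k=1,\dots,n-1$, choose $i_k\in\{k,\dots,n\}$ with $|A^{(k)}_{i_k k}| = \max_{k\le i\le n}|A^{(k)}_{ik}|$, taking $i_k=k$ if $|A^{(k)}_{kk}|$ is already maximal; interchange rows $k$ and $i_k$ of $A^{(k)}$ (no change if $i_k=k$); then eliminate the entries below the diagonal in column $k$ by subtracting multiples of row $k$ from rows $k+1,\dots,n$, giving $A^{(k+1)}$. This gives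 $PA=LU$ with $L$ unipotent lower triangular, $U=A^{(n)}$ upper triangular, and $P = P_{(n-1\ i_{n-1})}\cdots P_{(2\ i_2)}P_{(1\ i_1)}$, where $(k\ k)$ denotes the identity. Here $P_\sigma$ is the permutation matrix with $P_\sigma \mathbf e_i=\mathbf e_{\sigma(i)}$. $\Pi(A)\in\{0,\dots,n-1\}$ is the number of pivot movements used, i.e. the number of $k\in\{1,\dots,n-1\}$ with $i_k>k$. $\mathcal P_n$ is the set of $n\times n$ permutation matrices. $\Upsilon_n$ has the Stirling-1 distribution: $\mathbb P(\Upsilon_n=k)=|s(n,k)|/n!$ for $k=1,\dots,n$, where $s(n,k)$ is the Stirling number of the first kind, i.e. $x(x+1)\cdots(x+n-1)=\sum_{k=0}^n|s(n,k)|x^k$. Haar-butterfly matrices: let $B(\theta)=\begin{bmatrix}\cos\theta&\sin\theta\\-\sin\theta&\cos\theta\end{bmatrix}$. For $N=2^m$, $\operatorname{B}_s(N,\Sigma_S)$ is the law of $B(\boldsymbol\theta)=\bigotimes_{j=1}^m B(\theta_{m-j+1}) = B(\theta_m)\otimes\cdots\otimes B(\theta_1)$ (Kronecker product) with $\theta_1,\dots,\theta_m$ iid $\operatorname{Uniform}([0,2\pi))$. The butterfly permutation matrices are $\mathcal P_N^{(B)}=\left\{\bigotimes_{j=1}^m P_{(1\ 2)}^{e_j}: e_j\in\{0,1\}\right\}$, where $P_{(1\ 2)}$ is the $2\times2$ swap matrix and $P_{(1\ 2)}^0=\mathbf I_2$. *)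

(* Defs.v *)
From mathcomp Require Export all_boot all_order all_algebra finmap.
From mathcomp.real_closed Require Export complex mxtens.
From mathcomp Require Export all_classical all_reals all_analysis.

Set Implicit Arguments.
Unset Strict Implicit.
Unset Printing Implicit Defensive.

Import Order.TTheory GRing.Theory Num.Theory.
Import numFieldNormedType.Exports.
Local Open Scope classical_set_scope.
Local Open Scope ring_scope.

Inductive scalar_kind := RealScalars | ComplexScalars.

Definition scalar (R : realType) (K : scalar_kind) : numFieldType :=
  match K with RealScalars => R | ComplexScalars => R[i] end.

(* C is identified with R * R through (x, y) |-> x + iy, both for its Borel
   sets and for its (planar) Lebesgue measure. *)
Definition complex_preimage (R : realType) (S : set R[i]) :
    set (measurableTypeR R * measurableTypeR R) :=
  [set p | S (Complex p.1 p.2)].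

Definition scalar_borel (R : realType) (K : scalar_kind) :
    set (set (scalar R K)) :=
  match K return set (set (scalar R K)) with
  | RealScalars => fun S : set (measurableTypeR R) => measurable S
  | ComplexScalars => fun S => measurable (complex_preimage S)
  end.

Definition scalar_lebesgue (R : realType) (K : scalar_kind) :
    set (scalar R K) -> \bar R :=
  match K return set (scalar R K) -> \bar R with
  | RealScalars => fun S => lebesgue_measure S
  | ComplexScalars => fun S =>
      (lebesgue_measure \x lebesgue_measure)%E (complex_preimage S)
  end.

(* The product sigma-algebra on matrices, generated by the entries; [G] is the
   sigma-algebra on the scalars. *)
Definition mx_borel (F : Type) (G : set (set F)) {m n : nat} :
    set (set 'M[F]_(m, n)) :=
  <<s [set S | exists i j, exists2 U, G U & S = [set M : 'M[F]_(m, n) | U (M i j)]] >>.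

Section Random.
Context d (T : measurableType d) (R : realType) (mu : probability T R).

Definition random_element (U : Type) (G : set (set U)) (X : T -> U) : Prop :=
  forall S, G S -> measurable (X @^-1` S).

(* Mutual independence. The index type is finite and [G] is meant to be a
   sigma-algebra, so taking some of the [S i] to be [setT] gives the product
   rule for all subfamilies. *)
Definition independent (I : finType) (U : Type) (G : set (set U))
    (X : I -> T -> U) : Prop :=
  forall S : I -> set U, (forall i, G (S i)) ->
    mu (\bigcap_i (X i @^-1` S i)) = (\prod_i mu (X i @^-1` S i))%E.

Definition identically_distributed (I U : Type) (G : set (set U))
    (X : I -> T -> U) : Prop :=
  forall i j S, G S -> mu (X i @^-1` S) = mu (X j @^-1` S).

Definition absolutely_continuous (K : scalar_kind) (X : T -> scalar R K) :
    Prop :=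
  forall S, scalar_borel S -> scalar_lebesgue S = 0%E -> mu (X @^-1` S) = 0%E.

(* For discrete random variables, hence without a condition on [E]. *)
Definition has_law (U : Type) (X : T -> U) (L : set U -> \bar R) : Prop :=
  forall E : set U, mu (X @^-1` E) = L E.

End Random.

Section Laws.
Context (R : realType).

(* Meaningful for finite nonempty [S]. *)
Definition uniform_on (U : choiceType) (S E : set U) : \bar R :=
  (#|` fset_set (S `&` E)|%:R / #|` fset_set S|%:R)%:E.

(* |s(n,k)|, the coefficient of x^k in x (x + 1) ... (x + n - 1) *)
Definition abs_stirling1 (n k : nat) : R :=
  (\prod_(i < n) ('X + (i%:R)%:P) : {poly R})`_k.

Definition stirling1_law (n : nat) (E : set nat) : \bar R :=
  (\sum_(1 <= k < n.+1 | k \in E) abs_stirling1 n k / (n`!)%:R)%:E.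

(* The law of [f Y] when [Y] has law [L] *)
Definition image_law (U V : Type) (f : U -> V) (L : set U -> \bar R)
    (E : set V) : \bar R := L (f @^-1` E).

End Laws.

Section GEPP.
Context (F : numFieldType) (n : nat).

(* Rows and columns are numbered from 0, so that the elimination steps are
   indexed by 'I_n.-1. *)
Definition step_idx (k : 'I_n.-1) : 'I_n := widen_ord (leq_pred n) k.

(* When the pivot [A k k] has maximal modulus and vanishes, all the entries
   below it vanish too, and [x / 0 = 0] gives null multipliers. *)
Definition eliminate (k : 'I_n) (A : 'M[F]_n) : 'M[F]_n :=
  \matrix_(i, j) (if (k < i)%N then A i j - A i k / A k k * A k j else A i j).

(* [gepp_stage pv A t] is the matrix after [t] steps, [pv k] being the row
   exchanged with row [k] at step [k]; U is [gepp_stage pv A n.-1]. *)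
Fixpoint gepp_stage (pv : 'I_n.-1 -> 'I_n) (A : 'M[F]_n) (t : nat) : 'M[F]_n :=
  if t is t'.+1 then
    let M := gepp_stage pv A t' in
    if insub t' is Some k then
      eliminate (step_idx k) (xrow (step_idx k) (pv k) M)
    else M
  else A.

(* [pv] is a legitimate sequence of pivot rows for [A]. Ties between rows
   strictly below the diagonal may be broken in any way. *)
Definition gepp_pivots (A : 'M[F]_n) (pv : 'I_n.-1 -> 'I_n) : Prop :=
  forall k : 'I_n.-1,
    let M := gepp_stage pv A k in
    let maximal (i : 'I_n) :=
      (k <= i)%N /\
      forall i' : 'I_n, (k <= i')%N ->
        `|M i' (step_idx k)| <= `|M i (step_idx k)| in
    maximal (pv k) /\ (maximal (step_idx k) -> pv k = step_idx k).

Definition gepp_P (pv : 'I_n.-1 -> 'I_n) : 'M[F]_n :=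
  \big[mulmx/1%:M]_(k <- rev (enum 'I_n.-1)) tperm_mx (step_idx k) (pv k).

Definition perm_matrices : set 'M[F]_n := [set Q | is_perm_mx Q].

End GEPP.

Definition gepp_Pi (n : nat) (pv : 'I_n.-1 -> 'I_n) : nat :=
  #|[pred k : 'I_n.-1 | (k < pv k)%N]|.

Definition random_gepp_pivots d (T : measurableType d) (F : numFieldType)
    (n : nat) (A : T -> 'M[F]_n) (pv : T -> {ffun 'I_n.-1 -> 'I_n}) : Prop :=
  random_element setT pv /\ forall w, gepp_pivots (A w) (pv w).

Definition iid_continuous_columns d (T : measurableType d) (R : realType)
    (mu : probability T R) (K : scalar_kind) (n : nat)
    (A : T -> 'M[scalar R K]_n) : Prop :=
  [/\ random_element (mx_borel (@scalar_borel R K)) A,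
      independent mu (mx_borel (@scalar_borel R K))
        (fun (j : 'I_n) w => col j (A w)) &
      forall j : 'I_n, (j < n.-1)%N ->
        [/\ independent mu (@scalar_borel R K) (fun (i : 'I_n) w => A w i j),
            identically_distributed mu (@scalar_borel R K)
              (fun (i : 'I_n) w => A w i j) &
            forall i : 'I_n, absolutely_continuous mu (fun w => A w i j)]].

(* M_(m-1) *t ... *t M_0 *)
Fixpoint kron (F : pzRingType) (m : nat) : ('I_m -> 'M[F]_2) -> 'M[F]_(2 ^ m) :=
  if m is m'.+1 then fun M =>
    castmx (esym (expnS 2 m'), esym (expnS 2 m'))
      (M ord_max *t kron (fun i : 'I_m' => M (widen_ord (leqnSn m') i)))
  else fun=> 1%:M.

Section Butterfly.
Context (R : realType).

Definition rotation (t : R) : 'M[R]_2 :=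
  \matrix_(i, j) (if i == j then cos t
                  else if (i < j)%N then sin t else - sin t).

Definition butterfly (m : nat) (theta : 'I_m -> R) : 'M[R]_(2 ^ m) :=
  kron (fun j => rotation (theta j)).

Definition butterfly_perm_matrices (m : nat) : set 'M[R]_(2 ^ m) :=
  [set Q | exists e : 'I_m -> bool,
     Q = kron (fun j => if e j then tperm_mx ord0 ord_max else 1%:M)].

Lemma two_pi_gt0 : 0 < 2 * pi :> R.
Proof. by rewrite mulr_gt0// pi_gt0. Qed.

(* The law of [B] is that of [butterfly theta], with iid uniform angles living
   on some probability space. [uniform_prob] is the uniform law on the closed
   interval, which agrees with that on [0, 2 pi[. *)
Definition haar_butterfly d (T : measurableType d) (mu : probability T R)
    (m : nat) (B : T -> 'M[R]_(2 ^ m)) : Prop :=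
  let borel : set (set R) := fun S : set (measurableTypeR R) => measurable S in
  random_element (mx_borel borel) B /\
  exists (d' : measure_display) (T' : measurableType d')
         (mu' : probability T' R) (theta : 'I_m -> T' -> R),
    [/\ forall j, random_element borel (theta j),
        independent mu' borel theta,
        forall j S, borel S -> mu' (theta j @^-1` S) = uniform_prob two_pi_gt0 S
      & forall S, mx_borel borel S ->
          mu (B @^-1` S) = mu' ((fun w => butterfly (theta ^~ w)) @^-1` S)].

End Butterfly.

(* Main.v *)
(* A row exchange at step k commutes with the elimination steps before k, so
   GEPP on A is elimination without exchanges on PA. If in the latter every
   pivot is strictly dominant in its column, then P is the only permutation
   that GEPP can produce.

   (I) Permuting the rows of A does not change the law of its first n-1
   columns, so for all n! row permutations of A, strict dominance of all the
   pivots has the same probability. These events cover almost every outcome: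
   a tie at step k between rows i, j >= k constrains the entry (i, k) of A, the
   other entries being fixed, to a set |x + c| = r, which is Lebesgue-null.
   Hence each permutation has probability at least 1/n!, so exactly 1/n!. Pivot
   sequences with k <= i_k correspond bijectively to permutations, and expanding
   x (x + 1) ... (x + n - 1), where step k contributes x for i_k = k and 1 for
   each of the other choices of i_k, counts them by number of movements.

   (II) If b says whether |cos t| < |sin t|, then swapping the rows of B(t)
   when b holds gives a matrix L U with L unit lower triangular and an entry
   less than 1 in modulus below the diagonal; Kronecker products preserve this
   form, so P is the product of the swaps, and the m bits are independent and
   fair. The number of pivot movements is N minus the number of cycles of P,
   and a nontrivial butterfly permutation is an involution without fixed
   points. *)
From mathcomp Require Import all_fingroup.
From mathcomp Require Import zify ring lra measurable_realfun.
Require Import Defs.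

Set Implicit Arguments.
Unset Strict Implicit.
Unset Printing Implicit Defensive.

Import Order.TTheory GRing.Theory Num.Theory.
Import numFieldNormedType.Exports.
Local Open Scope classical_set_scope.
Local Open Scope ring_scope.

(** * Pivot sequences and permutations *)

Section Pivots.
Variable n : nat.
Implicit Types (p : 'I_n.-1 -> 'I_n) (s r : 'S_n) (t : nat) (k : 'I_n.-1).

Definition pivot_tperm p k : 'S_n := tperm (step_idx k) (p k).

(** The list is reversed because [perm_mx] turns products of permutations into matrix products in
    the same order: the latest exchange has to stand leftmost, as in [gepp_P]. *)
Definition head_perm p t : 'S_n :=
  (\prod_(k <- rev (take t (enum 'I_n.-1))) pivot_tperm p k)%g.

Definition tail_perm p t : 'S_n :=
  (\prod_(k <- rev (drop t (enum 'I_n.-1))) pivot_tperm p k)%g.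

Definition pivot_perm p : 'S_n := head_perm p n.-1.

Definition admissible p := forall k, (k <= p k)%N.

Definition fixes_below t s := forall i : 'I_n, (i < t)%N -> s i = i.

Lemma head_perm0 p : head_perm p 0 = 1%g.
Proof. by rewrite /head_perm take0 big_nil. Qed.

Lemma head_permS p k : head_perm p k.+1 = (pivot_tperm p k * head_perm p k)%g.
Proof.
have kn : (k < size (enum 'I_n.-1))%N by rewrite size_enum_ord.
by rewrite /head_perm (take_nth k kn) rev_rcons big_cons nth_ord_enum.
Qed.

Lemma tail_permS p k : tail_perm p k = (tail_perm p k.+1 * pivot_tperm p k)%g.
Proof.
have kn : (k < size (enum 'I_n.-1))%N by rewrite size_enum_ord.
by rewrite /tail_perm (drop_nth k kn) rev_cons big_rcons nth_ord_enum.
Qed.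

Lemma tail_permK p t : (tail_perm p t * head_perm p t)%g = pivot_perm p.
Proof.
rewrite /tail_perm /head_perm /pivot_perm -big_cat -rev_cat cat_take_drop.
by rewrite /head_perm take_oversize// size_enum_ord.
Qed.

Lemma gepp_PE (F : numFieldType) p : gepp_P F p = perm_mx (pivot_perm p).
Proof.
rewrite /gepp_P /pivot_perm /head_perm take_oversize ?size_enum_ord//.
elim: (rev _) => [|k l IH]; first by rewrite !big_nil perm_mx1.
by rewrite !big_cons perm_mxM IH.
Qed.

Lemma fixes_belowM t s r :
  fixes_below t s -> fixes_below t r -> fixes_below t (s * r)%g.
Proof. by move=> hs hr i it; rewrite permM hs// hr. Qed.

Lemma fixes_belowW t t' s : (t <= t')%N -> fixes_below t' s -> fixes_below t s.
Proof. by move=> tt' hs i it; rewrite hs// (leq_trans it). Qed.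

(** Fixing every index below [t], the injective map [s] sends no other index there. *)
Lemma fixes_below_le t s (i : 'I_n) :
  fixes_below t s -> (t <= s i)%N = (t <= i)%N.
Proof.
move=> hs; case: (ltnP i t) => it; first by rewrite hs// leqNgt it.
by case: (ltnP (s i) t) => // st; move: it; rewrite -(perm_inj (hs _ st)) leqNgt st.
Qed.

Lemma fixes_below_tperm t p k :
  admissible p -> (t <= k)%N -> fixes_below t (pivot_tperm p k).
Proof.
move=> hp tk i it; rewrite tpermD//; apply: contraTneq it => <-; rewrite -leqNgt//.
exact: leq_trans tk (hp k).
Qed.

Lemma fixes_below_tail t p : admissible p -> fixes_below t (tail_perm p t).
Proof.
move=> hp; rewrite /tail_perm big_seq.
elim/big_ind: _ => [i _||k]; [by rewrite perm1 | exact: fixes_belowM|].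
rewrite mem_rev => /(nthP k)[j]; rewrite size_drop size_enum_ord => jt <-.
rewrite nth_drop; apply: fixes_below_tperm => //.
by rewrite nth_enum_ord ?leq_addr// -ltn_subRL.
Qed.

(** The exchanges after step [k] leave index [k] alone, so only the transposition of step [k] acts
    on it. *)
Lemma tail_perm_pivot p k : admissible p -> tail_perm p k (step_idx k) = p k.
Proof.
move=> hp; rewrite tail_permS permM fixes_below_tail ?tpermL//=.
Qed.

(** The pivots are recovered one after the other: if the first [t] exchanges agree, cancelling them
    leaves equal tails, and [tail_perm_pivot] reads the next pivot off the tail. *)
Lemma pivot_perm_inj p q : admissible p -> admissible q ->
  pivot_perm p = pivot_perm q -> p =1 q.
Proof.
move=> hp hq pq.
have H t : (t <= n.-1)%N ->
    (forall k, (k < t)%N -> p k = q k) /\ head_perm p t = head_perm q t.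
  elim: t => [|t IH] tn; first by rewrite !head_perm0.
  have [hk hh] := IH (ltnW tn).
  pose k := Ordinal tn.
  have pk : p k = q k.
    rewrite -(tail_perm_pivot k hp) -(tail_perm_pivot k hq); congr (fun_of_perm _ _).
    by apply/(mulIg (head_perm p t)); rewrite {2}hh !tail_permK.
  split=> [j|]; last by rewrite !(head_permS _ k) /pivot_tperm /= pk hh.
  rewrite ltnS leq_eqVlt => /orP[/eqP jt|/hk//].
  by have -> : j = k by exact/val_inj.
by move=> k; case: (H n.-1) => // + _; exact.
Qed.

Lemma card_porbits1 : #|porbits (1 : 'S_n)%g| = n.
Proof.
have set1E (i : 'I_n) : porbit 1%g i = [set i]%SET.
  apply/setP => j; rewrite inE; apply/porbitP/eqP => [[u ->]|->].
    by rewrite expg1n perm1.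
  by exists 0%N; rewrite perm1.
rewrite /porbits (eq_imset _ set1E) card_imset ?card_ord//.
exact: set1_inj.
Qed.

(* [tail_perm p t.+1] fixes [t], so a nontrivial transposition of [t] with [p t]
   merges the cycle of [t] into another one. *)
Lemma card_porbits_tail p t : admissible p -> (t <= n.-1)%N ->
  (#|porbits (tail_perm p t)| + #|[pred k : 'I_n.-1 | (t <= k)%N && (k < p k)%N]| = n)%N.
Proof.
move=> hp; move: {2}(n.-1 - t)%N (erefl (n.-1 - t)%N) => e.
elim: e t => [|e IH] t te tn.
  have {te tn} -> : t = n.-1 by apply/eqP; rewrite eqn_leq tn -subn_eq0 te.
  rewrite [X in (_ + X)%N]eq_card0 ?addn0; last first.
    by move=> k; rewrite inE leqNgt ltn_ord.
  rewrite /tail_perm drop_oversize ?size_enum_ord// big_nil.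
  exact: card_porbits1.
have tn' : (t < n.-1)%N by rewrite -subn_gt0 te.
pose k := Ordinal tn'.
have {te} te : (n.-1 - t.+1)%N = e by rewrite subnS te.
have {IH te} IH := IH t.+1 te tn'.
(* [porbits_mul_tperm] has the transposition on the left, [tail_permS] on the right. Passing to
   inverses exchanges the sides and keeps the orbits. *)
have := porbits_mul_tperm (tail_perm p t.+1)^-1%g (step_idx k) (p k).
rewrite -/(pivot_tperm p k) /= -[pivot_tperm p k]tpermV -invMg.
rewrite -(tail_permS p k) !porbitsV => E.
have fx i : i \in porbit (tail_perm p t.+1) (step_idx k) -> i = step_idx k.
  move=> /porbitP[u ->]; elim: u => [|u IHu]; first by rewrite perm1.
  by rewrite expgSr permM IHu (fixes_below_tail hp).
have Ek : (step_idx k \notin porbit (tail_perm p t.+1)^-1%g (p k)) = (step_idx k != p k).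
  rewrite porbitV porbit_sym; congr (~~ _).
  by apply/idP/eqP => [/fx //|<-]; exact: porbit_id.
have nE : (step_idx k != p k) = (k < p k)%N.
  by rewrite ltn_neqAle hp andbT.
rewrite Ek nE in E.
rewrite (cardD1 k [pred k0 : 'I_n.-1 | (t <= k0)%N && (k0 < p k0)%N]) inE /= leqnn /=.
rewrite (@eq_card _ [predD1 [pred k0 : 'I_n.-1 | (t <= k0)%N && (k0 < p k0)%N] & k]
   [pred k0 : 'I_n.-1 | (t < k0)%N && (k0 < p k0)%N]); last first.
  by move=> j; rewrite !inE andbA; congr (_ && _); rewrite ltn_neqAle eq_sym.
have {}E : (#|porbits (tail_perm p t)| + (t < p k) = #|porbits (tail_perm p t.+1)|)%N.
  by apply/eqP; rewrite -(eqn_add2r (k < p k)) -addnA addnn; apply/eqP.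
by rewrite addnA E.
Qed.

Lemma card_porbits_pivot_perm p : admissible p ->
  (#|porbits (pivot_perm p)| + gepp_Pi p = n)%N.
Proof.
by move=> hp; rewrite -(tail_permK p 0) head_perm0 mulg1 (card_porbits_tail hp).
Qed.

End Pivots.

(** * Elimination with and without row exchanges *)

Section Elimination.
Context (F : numFieldType) (n : nat).
Implicit Types (A M : 'M[F]_n) (p : 'I_n.-1 -> 'I_n) (s r : {perm 'I_n}).
Implicit Types (t : nat) (k : 'I_n.-1).

Lemma perm_mx_inj : injective (@perm_mx F n).
Proof.
move=> s r /matrixP sr; apply/perm.permP => i; apply/eqP.
have := sr i (s i); rewrite !mxE eqxx eq_sym.
by case: (s i == r i) => // /eqP; rewrite eqr_nat.
Qed.

Definition plain_stage A t : 'M[F]_n := gepp_stage (@step_idx n) A t.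

Definition pivot_dominant A : Prop := forall k (i : 'I_n), (k < i)%N ->
  `|plain_stage A k i (step_idx k)| <
  `|plain_stage A k (step_idx k) (step_idx k)|.

Definition tie_free A : Prop := forall k (i j : 'I_n),
  (k <= i)%N -> (k <= j)%N -> i != j ->
  `|plain_stage A k i (step_idx k)| != `|plain_stage A k j (step_idx k)|.

Lemma gepp_stageS p A k : gepp_stage p A k.+1 =
  eliminate (step_idx k) (xrow (step_idx k) (p k) (gepp_stage p A k)).
Proof. by rewrite /= valK. Qed.

Lemma plain_stageS A k :
  plain_stage A k.+1 = eliminate (step_idx k) (plain_stage A k).
Proof.
rewrite /plain_stage gepp_stageS; congr eliminate.
by apply/matrixP => i j; rewrite /xrow tperm1 row_perm1.
Qed.

Lemma stage_ind (P : nat -> Prop) : P 0%N ->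
  (forall k, P k -> P k.+1) -> forall t, (t <= n.-1)%N -> P t.
Proof.
move=> P0 PS; elim=> [//|t IH] tn.
by have := PS (Ordinal tn); apply; apply: IH; exact: ltnW.
Qed.

(** [s] fixes the pivot row and the rows above it, and shuffles the rows below, which all undergo
    the same operation. *)
Lemma eliminate_row_perm k s A : fixes_below k.+1 s ->
  eliminate (step_idx k) (row_perm s A) = row_perm s (eliminate (step_idx k) A).
Proof.
move=> hs; apply/matrixP => i j; rewrite !mxE.
by rewrite (hs (step_idx k))// (fixes_below_le i hs).
Qed.

Lemma plain_stage_row_perm s A t : (t <= n.-1)%N -> fixes_below t s ->
  plain_stage (row_perm s A) t = row_perm s (plain_stage A t).
Proof.
move: t; apply: stage_ind => // k IH hs.
by rewrite !plain_stageS IH ?eliminate_row_perm//; apply: fixes_belowW hs.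
Qed.

Lemma gepp_stageE p A t : admissible p -> (t <= n.-1)%N ->
  gepp_stage p A t = plain_stage (row_perm (head_perm p t) A) t.
Proof.
move=> hp; move: t; apply: stage_ind => [|k IH].
  by rewrite head_perm0 row_perm1.
rewrite gepp_stageS plain_stageS IH head_permS row_permM.
rewrite (plain_stage_row_perm (s := pivot_tperm p k))// ?(ltnW (ltn_ord k))//.
exact: fixes_below_tperm.
Qed.

Lemma gepp_pivots_admissible A p : gepp_pivots A p -> admissible p.
Proof. by move=> hA k; have [[]] := hA k. Qed.

(** The discrepancy [s * (head_perm p k)^-1] is shown to fix one more index at each step. By
    induction, stage [k] of plain elimination on the permuted matrix is the GEPP stage with its rows
    shuffled by this discrepancy. Strict dominance in row [k] leaves a single row of maximal
    modulus, so GEPP must choose it, and the exchange makes the discrepancy fix [k] too. *)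
Lemma gepp_pivots_dominant A p s : gepp_pivots A p ->
  pivot_dominant (row_perm s A) -> pivot_perm p = s.
Proof.
move=> hA hs; have hp := gepp_pivots_admissible hA.
have : forall t, (t <= n.-1)%N -> fixes_below t (s * (head_perm p t)^-1)%g.
  apply: stage_ind => // k; set r := (s * _)%g => hr.
  have kn := ltnW (ltn_ord k).
  have sE : s = (r * head_perm p k)%g by rewrite /r mulgKV.
  have stE : plain_stage (row_perm s A) k = row_perm r (gepp_stage p A k).
    by rewrite sE row_permM plain_stage_row_perm// gepp_stageE.
  have rk : r (step_idx k) = p k.
    have [[kpk hmax] _] := hA k.
    apply/eqP; apply: contraT => rpk.
    have : (k <= r^-1%g (p k))%N.
      by rewrite -(fixes_below_le _ hr) permKV.
    rewrite leq_eqVlt => /orP[/eqP kE|kr].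
      by move: rpk; rewrite [step_idx k](_ : _ = r^-1%g (p k)) ?permKV ?eqxx//; exact/val_inj.
    have := hs _ _ kr; rewrite stE !mxE permKV.
    have := hmax (r (step_idx k)); rewrite (fixes_below_le _ hr) leqnn => /(_ isT).
    by move=> h1 h2; have := lt_le_trans h2 h1; rewrite ltxx.
  rewrite head_permS invMg tpermV mulgA -/r => i ik.
  rewrite permM; move: ik; rewrite ltnS leq_eqVlt => /orP[/eqP ik|ik].
    have -> : i = step_idx k by exact/val_inj.
    by rewrite rk tpermR.
  by rewrite hr// (fixes_below_tperm (t := k)).
move=> /(_ n.-1 (leqnn _)) hr.
(* A permutation that fixes all indices but the last fixes the last one as well. *)
have : (s * (pivot_perm p)^-1)%g = 1%g :> {perm _}.
  apply/perm.permP => i; rewrite perm1.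
  have [/hr//|ni] := ltnP i n.-1.
  have := fixes_below_le i hr; rewrite ni; move: (_ i) => j nj.
  by apply/val_inj => /=; have := ltn_ord i; have := ltn_ord j; lia.
by move/eqP; rewrite mulg_eq1 invgK => /eqP ->.
Qed.

(** Up to a shuffle of the rows from [k] on, stage [k] of the permuted matrix is the GEPP stage,
    with the chosen pivot in row [k]. Maximality of the pivot gives the weak inequality, and
    tie-freeness makes it strict. Ties are excluded for every [s] because the relevant one,
    [head_perm p k], depends on the pivots chosen. *)
Lemma tie_free_dominant A p : gepp_pivots A p ->
  (forall s, tie_free (row_perm s A)) ->
  pivot_dominant (row_perm (pivot_perm p) A).
Proof.
move=> hA hT k i ki; have hp := gepp_pivots_admissible hA.
have kn := ltnW (ltn_ord k).
have hr : fixes_below k (tail_perm p k) by exact: fixes_below_tail.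
rewrite -(tail_permK p k) row_permM plain_stage_row_perm//.
rewrite !mxE tail_perm_pivot// -gepp_stageE//.
have [[kpk hmax] _] := hA k.
rewrite lt_neqAle hmax ?fixes_below_le// ?andbT; last exact: ltnW.
rewrite gepp_stageE//; apply: hT => //.
  by rewrite fixes_below_le// ltnW.
by rewrite -tail_perm_pivot// (inj_eq perm_inj) neq_ltn ki orbT.
Qed.

(* Column [l] of the stages up to [l] depends additively on the entries of
   that column that lie on or below the diagonal. *)
Lemma plain_stage_shift A (a l : 'I_n) (c : F) t : (t <= n.-1)%N ->
  (t <= l)%N -> (t <= a)%N ->
  plain_stage (A + c *: delta_mx a l) t = plain_stage A t + c *: delta_mx a l.
Proof.
move: t; apply: stage_ind => // k IH kl ka.
rewrite !plain_stageS IH ?(ltnW kl) ?(ltnW ka)//.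
apply/matrixP => i j; rewrite !mxE.
have -> : (step_idx k == a) = false.
  by apply/negbTE; rewrite neq_ltn ka.
have -> : (step_idx k == l) = false.
  by apply/negbTE; rewrite neq_ltn kl.
rewrite /= !andbF /= !mulr0 !addr0; case: ifP => // _.
by rewrite addrAC.
Qed.

Definition unit_lower_lt1 (L : 'M[F]_n) : Prop :=
  [/\ forall i, L i i = 1, forall i j : 'I_n, (i < j)%N -> L i j = 0 &
      forall i j : 'I_n, (j < i)%N -> `|L i j| < 1].

Definition upper_nonzero_diag (U : 'M[F]_n) : Prop :=
  (forall i j : 'I_n, (j < i)%N -> U i j = 0) /\ forall i, U i i != 0.

Lemma leq_neq_ord (i j : 'I_n) : (i <= j)%N && (j != i) = (i < j)%N.
Proof. by rewrite andbC eq_sym ltn_neqAle. Qed.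

(** [L *m U] is a sum of rank-one terms, column [l] of [L] times row [l] of [U]. The multipliers of
    step [k] are the entries of column [k] of [L], so this step removes the term [l = k] from the
    rows below. *)
Lemma plain_stage_LU (L U : 'M[F]_n) t (i j : 'I_n) :
  unit_lower_lt1 L -> upper_nonzero_diag U -> (t <= n.-1)%N -> (t <= i)%N ->
  plain_stage (L *m U) t i j = \sum_(l < n | (t <= l)%N) L i l * U l j.
Proof.
move=> [L1 Lu _] [U0 Ud].
(* At stage [t'] the pivot row is already the final row of [U], since [L] is unit lower
   triangular. *)
have E t' (i' j' : 'I_n) : t' = i' :> nat ->
    \sum_(l < n | (t' <= l)%N) L i' l * U l j' = U i' j'.
  move=> ->; rewrite (bigD1 i')//= L1 mul1r big1 ?addr0// => l.
  by rewrite leq_neq_ord => /Lu ->; rewrite mul0r.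
move=> tn; move: t tn i j; apply: stage_ind => [i j _|k IH i j ki].
  by rewrite mxE.
rewrite plain_stageS mxE /= ki !IH ?leqnn ?(ltnW ki)//.
rewrite !(E k (step_idx k))//.
rewrite (bigD1 (step_idx k)) ?leqnn//= 
  [X in _ - X](_ : _ = L i (step_idx k) * U (step_idx k) j).
  rewrite addrAC subrr add0r; apply: eq_bigl => l.
  exact: (leq_neq_ord (step_idx k) l).
congr (_ * _); rewrite (bigD1 (step_idx k)) ?leqnn//= big1 ?addr0 ?mulfK// => l.
by rewrite (leq_neq_ord (step_idx k) l) => kl; rewrite U0 ?mulr0.
Qed.

(** At stage [k] the pivot column is column [k] of [L] scaled by [U k k], because [U] vanishes below
    its diagonal. *)
Lemma pivot_dominant_LU (L U : 'M[F]_n) :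
  unit_lower_lt1 L -> upper_nonzero_diag U -> pivot_dominant (L *m U).
Proof.
move=> hL hU k i ki; have [L1 Lu L2] := hL; have [U0 Ud] := hU.
have kn := ltnW (ltn_ord k).
have E (i' : 'I_n) : (k <= i')%N -> plain_stage (L *m U) k i' (step_idx k) =
    L i' (step_idx k) * U (step_idx k) (step_idx k).
  move=> ki'; rewrite plain_stage_LU// (bigD1 (step_idx k))//= big1 ?addr0// => l.
  by rewrite (leq_neq_ord (step_idx k) l) => kl; rewrite U0 ?mulr0.
by rewrite !E ?leqnn// ?(ltnW ki)// L1 mul1r normrM gtr_pMl ?normr_gt0//; exact: L2.
Qed.

End Elimination.

(** * Counting pivot sequences by number of movements *)

Section StirlingCount.
Context (R : realType) (n : nat).

Definition admissible_set : {set {ffun 'I_n.-1 -> 'I_n}} :=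
  [set p : {ffun 'I_n.-1 -> 'I_n} | [forall k : 'I_n.-1, (k <= p k)%N]]%SET.

Lemma admissible_setP (p : {ffun 'I_n.-1 -> 'I_n}) :
  reflect (admissible p) (p \in admissible_set).
Proof. by rewrite inE; exact: forallP. Qed.

Lemma gepp_Pi_le (p : 'I_n.-1 -> 'I_n) : (gepp_Pi p <= n.-1)%N.
Proof. by rewrite -[leqRHS](card_ord n.-1) max_card. Qed.

Lemma prod_XaddC_admissible : (1 <= n)%N ->
  \prod_(i < n) ('X + (i%:R)%:P) =
  \sum_(p in admissible_set) 'X^(n - gepp_Pi p) :> {poly R}.
Proof.
move=> n1.
have rowE (k : 'I_n.-1) : 'X + ((n.-1 - k)%N%:R)%:P =
    \sum_(q : 'I_n | (k <= q)%N) (if (k < q)%N then 1 else 'X) :> {poly R}.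
  rewrite (bigD1 (step_idx k)) ?leqnn//= ltnn; congr (_ + _).
  rewrite (eq_bigl (fun q : 'I_n => (k < q)%N)); last first.
    by move=> q; rewrite (leq_neq_ord (step_idx k) q).
  rewrite (eq_bigr (fun=> 1)) => [|q ->//].
  rewrite sumr_const -polyC1 -polyCMn; congr (_ *+ _)%:P.
  rewrite -sum1_card -(@big_geq_mkord _ _ _ k.+1 n predT (fun=> 1%N)).
  by rewrite sum_nat_const_nat muln1 subnS predn_sub.
(* The factor [i = 0] is a bare 'X, matched with no step: it turns the exponent n - 1 - Pi into n -
   Pi. The other factors are taken in reverse order, as step [k] has n - 1 - k rows below it. *)
transitivity ('X * \prod_(k < n.-1) ('X + ((n.-1 - k)%N%:R)%:P) : {poly R}).
  rewrite -(big_mkord predT (fun i => 'X + (i%:R)%:P)) -[in LHS](prednK n1).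
  rewrite big_mkord big_ord_recl /= addr0; congr (_ * _).
  rewrite [RHS](reindex_inj rev_ord_inj); apply: eq_bigr => i _ /=.
  congr (_ + (_%:R)%:P); have := ltn_ord i; rewrite /bump /=; lia.
rewrite (eq_bigr _ (fun k _ => rowE k)).
rewrite (bigA_distr_big_dep (fun (k : 'I_n.-1) (q : 'I_n) => (k <= q)%N)) big_distrr /=.
apply: eq_big => [p|p _].
  by apply/familyP/admissible_setP.
rewrite (bigID (fun k : 'I_n.-1 => (k < p k)%N))/= big1 ?mul1r; last by move=> k ->.
rewrite (eq_bigr (fun=> 'X)); last by move=> k /negbTE ->.
rewrite prodr_const -exprS; congr ('X^_).
have h : (gepp_Pi p + #|[predC [pred k : 'I_n.-1 | (k < p k)%N]]| = n.-1)%N.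
  by rewrite cardC card_ord.
rewrite (_ : #|_| = n.-1 - gepp_Pi p)%N; last first.
  by have := congr1 (subn^~ (gepp_Pi p)) h; rewrite /= addKn.
by rewrite -subSn ?gepp_Pi_le// prednK.
Qed.

(** Evaluation of the polynomial identity at 1. *)
Lemma card_admissible_set : (1 <= n)%N -> #|admissible_set| = n`!.
Proof.
move=> n1; have /(congr1 (fun q : {poly R} => q.[1])) := prod_XaddC_admissible n1.
rewrite horner_prod horner_sum (eq_bigr (fun i : 'I_n => (i.+1)%:R)); last first.
  by move=> i _; rewrite !hornerE -natr1 addrC.
have -> : \prod_(i < n) i.+1%:R = n`!%:R :> R.
  by rewrite -natr_prod fact_prod big_add1 big_mkord.
rewrite (eq_bigr (fun=> 1)); last by move=> p _; rewrite hornerXn expr1n.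
by rewrite sumr_const => /eqP; rewrite eqr_nat => /eqP.
Qed.

Lemma stirling1_lawE (E : set nat) : (1 <= n)%N ->
  image_law (fun u : nat => (n - u)%N) (@stirling1_law R n) E =
  ((#|[set p in admissible_set | gepp_Pi p \in E]%SET|)%:R / (n`!)%:R)%:E.
Proof.
move=> n1; rewrite /image_law /stirling1_law -mulr_suml; congr (_ / _)%:E.
rewrite (eq_bigr (fun k =>
  \sum_(p in admissible_set) ((n - gepp_Pi p)%N == k)%:R)); last first.
  move=> k _; rewrite /abs_stirling1 prod_XaddC_admissible// coef_sum.
  by apply: eq_bigr => p _; rewrite coefXn eq_sym.
rewrite exchange_big /= -sum1_card natr_sum.
rewrite [RHS](eq_bigl (fun p => (p \in admissible_set) && (gepp_Pi p \in E))); last first.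
  by move=> p; rewrite inE.
rewrite [RHS]big_mkcondr /=.
apply: eq_bigr => p _; have pn := gepp_Pi_le p.
have nn : (n - (n - gepp_Pi p))%N = gepp_Pi p by rewrite subKn// (leq_trans pn)// leq_pred.
(* Since Pi is at most n - 1, the value n - Pi lies in the range from 1 to n, so [p] is counted for
   exactly one index. *)
rewrite big_mkcond (bigD1_seq (n - gepp_Pi p)%N) ?iota_uniq//=; last first.
  by rewrite mem_index_iota; lia.
rewrite big1 => [|k kn]; last by rewrite eq_sym (negbTE kn) if_same.
by rewrite eqxx addr0 /= -{2}nn; congr (if _ then _ else _); apply/idP/idP; rewrite !inE.
Qed.

End StirlingCount.

(** * Measurability and ties *)

Section FiniteUniform.
Context d (T : measurableType d) (R : realType) (mu : probability T R).

(* The lower bounds add up to 1, so they are attained. *)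
Lemma uniform_law_lower_bound (I : finType) (U : Type) (A : {set I})
    (f : I -> U) (X : T -> U) : (0 < #|A|)%N ->
  random_element setT X -> {in A &, injective f} ->
  (forall i, i \in A -> ((#|A|%:R^-1)%:E <= mu (X @^-1` [set f i]))%E) ->
  forall E : set U, mu (X @^-1` E) =
    (#|[set i in A | f i \in E]%SET|%:R / #|A|%:R)%:E.
Proof.
move=> A0 mX0 fI hA.
have mX (S : set U) : measurable (X @^-1` S) by exact: mX0.
pose c (E : set U) : R := #|[set i in A | f i \in E]%SET|%:R / #|A|%:R.
have lower (E : set U) : ((c E)%:E <= mu (X @^-1` E))%E.
  pose B := [set i in A | f i \in E]%SET.
  have BA i : i \in enum B -> i \in A by rewrite mem_enum inE => /andP[].
  have BE i : i \in enum B -> E (f i) by rewrite mem_enum inE => /andP[_ /set_mem].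
  have -> : (c E)%:E = (\sum_(i \in [set` enum B]) ((#|A|%:R : R)^-1)%:E)%E.
    by rewrite -fsbig_seq ?enum_uniq// big_enum /= sumEFin sumr_const /c mulr_natl.
 apply: (@le_trans _ _ (\sum_(i \in [set` enum B]) mu (X @^-1` [set f i]))%E).
    apply: lee_fsum => // i; exact: (fun h => hA i (BA i h)).
  rewrite -measure_fin_bigcup//; last first.
    move=> i j iB jB [w [/= Xi Xj]]; apply: fI; [exact: BA|exact: BA|].
    by rewrite -Xi -Xj.
  apply: le_measure; rewrite ?inE.
  - by apply: fin_bigcup_measurable => // i _; exact: mX.
  - exact: mX.
  - by move=> w [i iB /= ->]; exact: BE.
move=> E; apply/eqP; rewrite eq_le -/(c E) lower andbT.
have cC : c E + c (~` E) = 1.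
  rewrite /c -mulrDl -natrD [X in X%:R](_ : _ = #|A|) ?mulfV ?pnatr_eq0 -?lt0n//.
  rewrite -(cardsID [set i | f i \in E]%SET A); congr (_ + _)%N; apply: eq_card => i.
    by rewrite !inE.
  by rewrite !inE andbC; congr (_ && _); apply/idP/idP => [/set_mem|] h;
    [apply/negP => /set_mem|apply/mem_set => ?; move/negP: h; apply; exact/mem_set].
rewrite -{1}(setCK E) -preimage_setC probability_setC//.
rewrite leeBlDr ?fin_num_measure//.
by rewrite -cC EFinD leeD2l.
Qed.

Lemma has_law_uniform_on (I : finType) (U : choiceType) (f : I -> U)
    (X : T -> U) : (0 < #|I|)%N -> random_element setT X -> injective f ->
  (forall i, ((#|I|%:R^-1)%:E <= mu (X @^-1` [set f i]))%E) ->
  has_law mu X (uniform_on R (range f)).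
Proof.
move=> I0 mX fI hI E.
rewrite (@uniform_law_lower_bound I U [set: I]%SET f X)//; last 3 first.
- by rewrite cardsT.
- by move=> i j _ _ /fI.
- by move=> i _; rewrite cardsT.
have cardV (B : {set I}) (V : set U) : (forall u, V u <-> exists2 i, i \in B & f i = u) ->
    #|` fset_set V| = #|B|.
  move=> VB; rewrite (_ : fset_set V = [fset f i | i in B]%fset).
    by rewrite card_imfset //= -cardE.
  apply/fsetP => u; rewrite in_fset_set; last first.
    apply: (@sub_finite_set _ _ (range f)); last exact: finite_image.
    by move=> v /VB[i _ <-]; exists i.
  apply/idP/imfsetP => [/set_mem/VB[i iB <-]|[i iB ->]]; first by exists i.
  by apply/mem_set/VB; exists i.
rewrite /uniform_on (cardV [set i in [set: I]%SET | f i \in E]%SET); last first.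
  move=> u; split=> [[[i _ <-] Ei]|[i ]]; last first.
    by rewrite !inE => Ei <-; split; [by exists i|].
  by exists i => //; rewrite !inE.
rewrite (cardV [set: I]%SET)// => u; split=> [[i _ <-]|[i _ <-]]; exists i => //.
Qed.

End FiniteUniform.

(** * Measurability of field operations and moduli *)

Section ScalarMeasurability.
Context d (T : measurableType d) (R : realType).

(** Inversion is continuous on the open set of nonzero reals; the point 0, where the inverse is 0,
    is treated apart. *)
Lemma measurable_inv : measurable_fun setT (fun x : R => x^-1).
Proof.
rewrite -(setvU [set 0]); apply/measurable_funU => //.
  exact: measurableC.
split; last exact: measurable_fun_set1.
apply: open_continuous_measurable_fun.
  by rewrite openC; exact: closed_eq.
by move=> x; rewrite inE /= => /eqP x0; exact: inv_continuous.
Qed.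

Implicit Types K : scalar_kind.
Local Notation reC := (@complex.Re R).
Local Notation imC := (@complex.Im R).

Lemma random_element_real (f : T -> R) :
  random_element (@scalar_borel R RealScalars) f <-> measurable_fun setT f.
Proof.
split=> [mf _ Y mY|mf Y mY]; first by rewrite setTI; exact: mf.
by rewrite -[X in measurable X]setTI; exact: mf.
Qed.

Lemma random_element_complex (f : T -> R[i]) :
  random_element (@scalar_borel R ComplexScalars) f <->
  measurable_fun setT (reC \o f) /\ measurable_fun setT (imC \o f).
Proof.
split=> [mf|[mr mi] Y mY].
  split=> _ Y mY; rewrite setTI.
    apply: (mf [set z | Y (reC z)]); rewrite /scalar_borel.
    have -> : complex_preimage [set z | Y (reC z)] = Y `*` setT.
      by apply/seteqP; split=> [[x y] //|[x y] []].
    exact: measurableX.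
  apply: (mf [set z | Y (imC z)]); rewrite /scalar_borel.
  have -> : complex_preimage [set z | Y (imC z)] = setT `*` Y.
    by apply/seteqP; split=> [[x y] //|[x y] []].
  exact: measurableX.
have := measurable_fun_pair mr mi measurableT mY.
rewrite setTI; congr measurable; apply/seteqP; split=> w /=;
  by rewrite /complex_preimage /=; case: (f w).
Qed.

Lemma random_elementN K (f : T -> scalar R K) :
  random_element (@scalar_borel R K) f ->
  random_element (@scalar_borel R K) (fun w => - f w).
Proof.
case: K f => f.
  by move=> /random_element_real mf; apply/random_element_real/measurable_funN.
move=> /random_element_complex[mr mi]; apply/random_element_complex; split.
  rewrite (_ : _ \o _ = fun w => - reC (f w)); first exact: measurable_funN.
  by apply/funext => w /=; case: (f w).
rewrite (_ : _ \o _ = fun w => - imC (f w)); first exact: measurable_funN.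
by apply/funext => w /=; case: (f w).
Qed.

Lemma random_elementD K (f g : T -> scalar R K) :
  random_element (@scalar_borel R K) f -> random_element (@scalar_borel R K) g ->
  random_element (@scalar_borel R K) (fun w => f w + g w).
Proof.
case: K f g => f g.
  move=> /random_element_real mf /random_element_real mg.
  exact/random_element_real/measurable_funD.
move=> /random_element_complex[mr mi] /random_element_complex[mr' mi'].
apply/random_element_complex; split.
  rewrite (_ : _ \o _ = fun w => reC (f w) + reC (g w)).
    exact: measurable_funD.
  by apply/funext => w /=; case: (f w); case: (g w).
rewrite (_ : _ \o _ = fun w => imC (f w) + imC (g w)).
  exact: measurable_funD.
by apply/funext => w /=; case: (f w); case: (g w).
Qed.

Lemma random_elementM K (f g : T -> scalar R K) :
  random_element (@scalar_borel R K) f -> random_element (@scalar_borel R K) g ->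
  random_element (@scalar_borel R K) (fun w => f w * g w).
Proof.
case: K f g => f g.
  move=> /random_element_real mf /random_element_real mg.
  exact/random_element_real/measurable_funM.
move=> /random_element_complex[mr mi] /random_element_complex[mr' mi'].
apply/random_element_complex; split.
  rewrite (_ : _ \o _ = fun w => reC (f w) * reC (g w) -
      imC (f w) * imC (g w)).
    by apply: measurable_funB; exact: measurable_funM.
  by apply/funext => w /=; case: (f w); case: (g w).
rewrite (_ : _ \o _ = fun w => reC (f w) * imC (g w) +
    imC (f w) * reC (g w)).
  by apply: measurable_funD; exact: measurable_funM.
by apply/funext => w /=; case: (f w); case: (g w).
Qed.

Lemma random_elementV K (f : T -> scalar R K) :
  random_element (@scalar_borel R K) f ->
  random_element (@scalar_borel R K) (fun w => (f w)^-1).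
Proof.
case: K f => f.
  move=> /random_element_real mf; apply/random_element_real.
  exact: measurableT_comp measurable_inv mf.
move=> /random_element_complex[mr mi].
have mn : measurable_fun setT (fun w => (reC (f w) ^+ 2 + imC (f w) ^+ 2)^-1).
  apply: (measurableT_comp measurable_inv).
  by apply: measurable_funD; exact: measurable_funX.
apply/random_element_complex; split.
  rewrite (_ : _ \o _ = fun w => reC (f w) *
      (reC (f w) ^+ 2 + imC (f w) ^+ 2)^-1).
    exact: measurable_funM.
  by apply/funext => w /=; case: (f w).
rewrite (_ : _ \o _ = fun w => - (imC (f w) *
    (reC (f w) ^+ 2 + imC (f w) ^+ 2)^-1)).
  by apply: measurable_funN; exact: measurable_funM.
by apply/funext => w /=; case: (f w).
Qed.

(** The modulus takes values in the scalar field, possibly [R[i]]. Its square, read in [R], is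
    polynomial in the real and imaginary parts, so comparisons of moduli become comparisons of
    measurable real functions. *)
Definition sqnorm K : scalar R K -> R :=
  match K with
  | RealScalars => fun x => x ^+ 2
  | ComplexScalars => fun z => reC z ^+ 2 + imC z ^+ 2
  end.

Lemma ltr_norm_sqnorm K (x y : scalar R K) : (`|x| < `|y|) = (sqnorm x < sqnorm y).
Proof.
case: K x y => x y /=; first by rewrite -ltr_sqr ?nnegrE// !real_normK// num_real.
rewrite !normc_def ltcR.
by rewrite -ltr_sqr ?nnegrE ?sqrtr_ge0// !sqr_sqrtr// addr_ge0 ?sqr_ge0.
Qed.

Lemma eqr_norm_sqnorm K (x y : scalar R K) : (`|x| == `|y|) = (sqnorm x == sqnorm y).
Proof.
case: K x y => x y /=.
  by rewrite -(eqrXn2 (n := 2))// !real_normK// num_real.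
rewrite !normc_def (inj_eq (@complexI _)) -(eqrXn2 (n := 2)) ?sqrtr_ge0//.
by rewrite !sqr_sqrtr// addr_ge0 ?sqr_ge0.
Qed.

Lemma measurable_sqnorm K (f : T -> scalar R K) :
  random_element (@scalar_borel R K) f ->
  measurable_fun setT (fun w => sqnorm (f w)).
Proof.
case: K f => f; first by move=> /random_element_real mf; exact: measurable_funX.
move=> /random_element_complex[mr mi].
by apply: measurable_funD; exact: measurable_funX.
Qed.

End ScalarMeasurability.

(** * Events determined by the first n-1 columns *)

Section Boxes.
Context (R : realType) (K : scalar_kind) (n : nat).
Local Notation F := (scalar R K).
Local Notation borel := (@scalar_borel R K).

Definition box (U : 'I_n -> 'I_n -> set F) : set 'M[F]_n :=
  [set M | forall i j, U i j (M i j)].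

(* The last column never takes part in a pivot choice, and its law is
   arbitrary, so the boxes leave it free. *)
Definition pivot_box (U : 'I_n -> 'I_n -> set F) : Prop :=
  (forall i j, borel (U i j)) /\
  (forall i (j : 'I_n), (n.-1 <= j)%N -> U i j = setT).

Definition pivot_boxes : set (set 'M[F]_n) :=
  [set S | exists2 U, pivot_box U & S = box U].

Lemma scalar_borelT : borel setT.
Proof. by rewrite /scalar_borel; case: K => //; exact: measurableT. Qed.

Lemma scalar_borelI A B : borel A -> borel B -> borel (A `&` B).
Proof. by rewrite /scalar_borel; move: A B; case: K => A B; exact: measurableI. Qed.

Lemma pivot_boxes_setI : setI_closed pivot_boxes.
Proof.
move=> _ _ [U [mU UT] ->] [V [mV VT] ->].
exists (fun i j => U i j `&` V i j).
  split=> [i j|i j ij]; first exact: scalar_borelI.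
  by rewrite UT// VT// setTI.
apply/seteqP; split=> [M [MU MV] i j|M MUV]; first by split.
by split=> i j; have [] := MUV i j.
Qed.

Section PivotSets.
Context d (T : measurableType d) (X : T -> 'M[F]_n).
Hypothesis mX : forall i j : 'I_n, (j < n.-1)%N ->
  random_element borel (fun w => X w i j).

Lemma measurable_pivot_sets S : <<s pivot_boxes >> S -> measurable (X @^-1` S).
Proof.
move: S; apply: smallest_sub.
  split=> [|S mS|G mG]; first by rewrite preimage_set0; exact: measurable0.
    by rewrite setTD -preimage_setC; exact: measurableC.
  by rewrite preimage_bigcup; exact: bigcup_measurable.
move=> _ [U [mU UT] ->].
have -> : X @^-1` box U =
    \bigcap_(ij in [set: 'I_n * 'I_n]) [set w | U ij.1 ij.2 (X w ij.1 ij.2)].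
  by apply/seteqP; split=> [w Xw ij _|w Xw i j]; [exact: Xw|exact: (Xw (i, j))].
apply: fin_bigcap_measurable => [|[i j] _ /=]; first exact: finite_finset.
have [jn|jn] := ltnP j n.-1; first exact: mX.
by rewrite UT//; exact: measurableT.
Qed.

(** Each entry of the next stage is a rational expression in columns [k] and [j] of the current one,
    and both avoid the last column. *)
Lemma random_plain_stage t (i j : 'I_n) : (t <= n.-1)%N -> (j < n.-1)%N ->
  random_element borel (fun w => plain_stage (X w) t i j).
Proof.
move=> tn; move: t tn i j; apply: stage_ind => [i j jn|k IH i j jn]; first exact: mX.
rewrite (_ : (fun w => _) = (fun w => if (k < i)%N then
    plain_stage (X w) k i j + - (plain_stage (X w) k i (step_idx k) *
      (plain_stage (X w) k (step_idx k) (step_idx k))^-1 *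
      plain_stage (X w) k (step_idx k) j) else plain_stage (X w) k i j)); last first.
  by apply/funext => w; rewrite plain_stageS mxE.
case: (k < i)%N; last exact: IH.
have kn : (step_idx k < n.-1)%N := ltn_ord k.
apply: random_elementD; first exact: IH.
apply: random_elementN; apply: random_elementM; last exact: IH.
by apply: random_elementM; [exact: IH|apply: random_elementV; exact: IH].
Qed.

Lemma measurable_pivot_dominant : measurable [set w | pivot_dominant (X w)].
Proof.
have -> : [set w | pivot_dominant (X w)] = \bigcap_(ki in [set: 'I_n.-1 * 'I_n])
    [set w | (ki.1 < ki.2)%N -> `|plain_stage (X w) ki.1 ki.2 (step_idx ki.1)| <
      `|plain_stage (X w) ki.1 (step_idx ki.1) (step_idx ki.1)|].
  by apply/seteqP; split=> [w Xw ki _|w Xw k i]; [exact: Xw|exact: (Xw (k, i))].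
apply: fin_bigcap_measurable => [|[k i] _ /=]; first exact: finite_finset.
case: (k < i)%N; last first.
  by rewrite (_ : [set _ | _] = setT)//; apply/seteqP; split.
have st i' : random_element borel (fun w => plain_stage (X w) k i' (step_idx k)).
  by apply: random_plain_stage; [exact: ltnW|exact: (ltn_ord k)].
rewrite (_ : [set _ | _] = [set w | sqnorm (plain_stage (X w) k i (step_idx k)) <
    sqnorm (plain_stage (X w) k (step_idx k) (step_idx k))]); last first.
  by apply/seteqP; split=> w /=; rewrite ltr_norm_sqnorm => h; [exact: h|move=> _].
rewrite -[X in measurable X]setTI.
by apply: measurable_fun_ltr => //; apply: measurable_sqnorm.
Qed.

Lemma measurable_tie (k : 'I_n.-1) (i j : 'I_n) :
  measurable [set w | `|plain_stage (X w) k i (step_idx k)| ==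
                      `|plain_stage (X w) k j (step_idx k)|].
Proof.
have st i' : random_element borel (fun w => plain_stage (X w) k i' (step_idx k)).
  by apply: random_plain_stage; [exact: ltnW|exact: (ltn_ord k)].
rewrite (_ : [set _ | _] = [set w | sqnorm (plain_stage (X w) k i (step_idx k)) ==
    sqnorm (plain_stage (X w) k j (step_idx k))]); last first.
  by apply/seteqP; split=> w /=; rewrite eqr_norm_sqnorm.
rewrite -[X in measurable X]setTI.
by apply: measurable_fun_eqr => //; apply: measurable_sqnorm.
Qed.

End PivotSets.

(** This makes the measurability lemmas above applicable to the identity map on matrices with the
    sigma-algebra of the boxes; they then say that dominance and ties belong to this
    sigma-algebra. *)
Lemma pivot_sets_entry (i j : 'I_n) : (j < n.-1)%N ->
  random_element borel (fun M : g_sigma_algebraType pivot_boxes => M i j).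
Proof.
move=> jn S mS; apply: sub_sigma_algebra.
exists (fun i' j' => if (i' == i) && (j' == j) then S else setT).
  split=> [i' j'|i' j' jn']; first by case: ifP => // _; exact: scalar_borelT.
  by case: ifPn => // /andP[_ /eqP jj]; move: jn'; rewrite jj leqNgt jn.
apply/seteqP; split=> [M MS i' j'|M MS].
  by case: ifP => // /andP[/eqP -> /eqP ->].
by have := MS i j; rewrite !eqxx.
Qed.

Lemma pivot_dominant_pivot_sets : <<s pivot_boxes >> [set M | pivot_dominant M].
Proof. exact: (measurable_pivot_dominant pivot_sets_entry). Qed.

Lemma tie_pivot_sets (k : 'I_n.-1) (i j : 'I_n) :
  <<s pivot_boxes >> [set M : 'M[F]_n | `|plain_stage M k i (step_idx k)| ==
                          `|plain_stage M k j (step_idx k)|].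
Proof. exact: (measurable_tie pivot_sets_entry). Qed.

(** Pi-lambda argument: boxes are stable under intersection, and the sets on which the two laws
    agree form a lambda-system. The full space is a box, so the total masses agree, and finiteness
    handles complements. Two sample spaces are allowed so as to compare [A] with a matrix built on a
    product space. *)
Lemma pivot_law_unique d1 (T1 : measurableType d1) (mu1 : {measure set T1 -> \bar R})
    (X1 : T1 -> 'M[F]_n) d2 (T2 : measurableType d2)
    (mu2 : {measure set T2 -> \bar R}) (X2 : T2 -> 'M[F]_n) :
  (forall i j : 'I_n, (j < n.-1)%N -> random_element borel (fun w => X1 w i j)) ->
  (forall i j : 'I_n, (j < n.-1)%N -> random_element borel (fun w => X2 w i j)) ->
  (mu1 setT < +oo)%E ->
  (forall U, pivot_box U -> mu1 (X1 @^-1` box U) = mu2 (X2 @^-1` box U)) ->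
  forall S, <<s pivot_boxes >> S -> mu1 (X1 @^-1` S) = mu2 (X2 @^-1` S).
Proof.
move=> mX1 mX2 fin eqb.
have m1 := measurable_pivot_sets mX1; have m2 := measurable_pivot_sets mX2.
have eqT : mu1 setT = mu2 setT.
  have := eqb (fun _ _ => setT); rewrite (_ : box _ = setT); last by apply/seteqP; split.
  by rewrite !preimage_setT; apply; split=> // i j; exact: scalar_borelT.
pose H := [set S | <<s pivot_boxes >> S /\ mu1 (X1 @^-1` S) = mu2 (X2 @^-1` S)].
suff : <<s pivot_boxes >> `<=` H by move=> h S /h[].
apply: (lambda_system_subset pivot_boxes_setI) => //; last first.
- by move=> _ [U bU ->]; split; [apply: sub_sigma_algebra; exists U|exact: eqb].
- apply/dynkin_lambda_system; split.
  + by split; [exact: (@measurableT _ (g_sigma_algebraType pivot_boxes))|rewrite !preimage_setT].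
  + move=> S [sS eS]; split; first exact: (@sigma_algebraC _ pivot_boxes).
    have := m1 S sS; have := m2 S sS; have fin2 : (mu2 setT < +oo)%E by rewrite -eqT.
    move=> mS2 mS1; rewrite -!preimage_setC -!setTD !measureD// !setTI.
    exact: (congr2 (fun a b => a - b)%E eqT eS).
  + move=> G tG HG; split; first by apply: (@sigma_algebra_bigcup _ setT) => i; case: (HG i).
    have tX (V : Type) (X : V -> 'M[F]_n) : trivIset setT (fun i => X @^-1` G i).
      by move=> i j _ _ [w [Gi Gj]]; apply: tG => //; exists (X w).
    rewrite !preimage_bigcup !measure_bigcup//.
    - by apply: eq_eseriesr => i _; case: (HG i).
    - by move=> i _; apply: m2; case: (HG i).
    - by move=> i _; apply: m1; case: (HG i).
Qed.

End Boxes.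

(** * Null level sets of the modulus *)

Section Circles.
Context (R : realType).

Lemma sqr_level_set (a r : R) : finite_set [set x : R | (x + a) ^+ 2 = r].
Proof.
apply: (@sub_finite_set _ _ [set Num.sqrt r - a; - Num.sqrt r - a]); last first.
  exact: finite_set2.
move=> x /= <-; rewrite sqrtr_sqr.
have [h|h] := ger0P (x + a); [left|right]; ring.
Qed.

Lemma measurable_sqr_level_set (a r : R) :
  measurable ([set x | (x + a) ^+ 2 = r] : set (measurableTypeR R)).
Proof.
apply: countable_measurable; last exact/finite_set_countable/sqr_level_set.
by move=> t; exact: measurable_set1.
Qed.

(** In the real case the set is finite. In the complex case each section at a fixed real part is
    finite, so the iterated integral vanishes. *)
Lemma sqnorm_circle (K : scalar_kind) (a : scalar R K) (r : R) :
  scalar_borel [set x : scalar R K | sqnorm (x + a) = r] /\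
  scalar_lebesgue [set x : scalar R K | sqnorm (x + a) = r] = 0%E.
Proof.
case: K a => a /=.
  split; first exact: measurable_sqr_level_set.
  by rewrite countable_lebesgue_measure0//; exact/finite_set_countable/sqr_level_set.
case: a => a b; rewrite /complex_preimage /=.
split.
  have mf : measurable_fun setT (fun p : measurableTypeR R * measurableTypeR R =>
      (p.1 + a) ^+ 2 + (p.2 + b) ^+ 2).
    by apply: measurable_funD; apply: measurable_funX; apply: measurable_funD.
  by have := mf measurableT [set r] (measurable_set1 r); rewrite setTI.
rewrite /product_measure1 integral0_eq// => x _ /=.
rewrite countable_lebesgue_measure0//; apply: finite_set_countable.
rewrite (_ : xsection _ _ = [set y | (y + b) ^+ 2 = r - (x + a) ^+ 2]).
  exact: sqr_level_set.
apply/seteqP; split => y; rewrite /xsection /= inE /=.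
  by move=> <-; rewrite addrAC subrr add0r.
by move=> ->; rewrite addrC subrK.
Qed.

End Circles.

(** * GEPP on matrices with iid continuous columns *)

Section IidColumns.
Context d (T : measurableType d) (R : realType) (mu : probability T R).
Context (K : scalar_kind) (n : nat) (A : T -> 'M[scalar R K]_n).
Hypothesis hA : iid_continuous_columns mu A.
Local Notation F := (scalar R K).
Local Notation borel := (@scalar_borel R K).

Lemma random_entry i j : random_element borel (fun w => A w i j).
Proof.
have [mA _ _] := hA => S mS; apply: (mA [set M | S (M i j)]).
by apply: sub_sigma_algebra; exists i, j, S.
Qed.

(** Independence of the columns splits the box by columns, then independence inside each of the
    first n-1 columns splits it by entries. The last column contributes only factors 1. *)
Lemma pivot_box_law (U : 'I_n -> 'I_n -> set F) : pivot_box U ->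
  mu (A @^-1` box U) =
  (\prod_(ij : 'I_n * 'I_n) mu [set w | U ij.1 ij.2 (A w ij.1 ij.2)])%E.
Proof.
move=> [mU UT]; have [mA iA colA] := hA.
pose S (j : 'I_n) := [set c : 'cV[F]_n | forall i, U i j (c i ord0)].
have mS j : mx_borel borel (S j).
  rewrite (_ : S j = \bigcap_(i in [set: 'I_n]) [set c | U i j (c i ord0)]); last first.
    by apply/seteqP; split=> [c h i _|c h i]; apply: h.
  rewrite /mx_borel.
  apply: (@fin_bigcap_measurable _ (g_sigma_algebraType
    [set S | exists (i : 'I_n) (j : 'I_1),
       exists2 U, borel U & S = [set M : 'M[F]_(n, 1) | U (M i j)]])) => [|i _].
    exact: finite_finset.
  by apply: sub_sigma_algebra; exists i, ord0, (U i j).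
have -> : A @^-1` box U = \bigcap_j ((fun w => col j (A w)) @^-1` S j).
  apply/seteqP; split=> [w h j _ i|w h i j]; first by rewrite mxE; exact: h.
  by have := h j Logic.I i; rewrite mxE.
rewrite iA// -(pair_bigA _ (fun i j => mu [set w | U i j (A w i j)])) exchange_big /=.
apply: eq_bigr => j _.
have -> : (fun w => col j (A w)) @^-1` S j = \bigcap_i ((fun w => A w i j) @^-1` U i j).
  apply/seteqP; split=> [w h i _|w h i]; last by rewrite mxE; exact: h.
  by have := h i; rewrite mxE.
have [jn|jn] := ltnP j n.-1.
  by have [iAj _ _] := colA j jn; rewrite iAj.
rewrite big1 => [|i _].
  rewrite (_ : \bigcap_i _ = setT) ?probability_setT//.
  by apply/seteqP; split=> // w _ i _; rewrite UT.
by rewrite UT// (_ : [set _ | _] = setT) ?probability_setT.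
Qed.

Lemma pivot_box_law_row_perm (s : {perm 'I_n}) U : pivot_box U ->
  mu ((fun w => row_perm s (A w)) @^-1` box U) = mu (A @^-1` box U).
Proof.
move=> bU; have [mU UT] := bU.
pose V i j := U (s^-1%g i) j.
have -> : (fun w => row_perm s (A w)) @^-1` box U = A @^-1` box V.
  apply/seteqP; split=> [w h i j|w h i j].
    by have := h (s^-1%g i) j; rewrite mxE permKV.
  by have := h (s i) j; rewrite mxE /V permK.
rewrite !pivot_box_law//; last by split=> [i j|i j jn]; [exact: mU|exact: UT].
rewrite -(pair_bigA _ (fun i j => mu [set w | V i j (A w i j)])).
rewrite -(pair_bigA _ (fun i j => mu [set w | U i j (A w i j)])) /=.
rewrite exchange_big [RHS]exchange_big /=; apply: eq_bigr => j _.
rewrite (reindex_inj (@perm_inj _ s)); apply: eq_bigr => i _.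
rewrite /V permK; have [jn|jn] := ltnP j n.-1; last by rewrite UT.
by have [_ _ /(_ j jn)[_ idA _]] := hA; exact: (idA (s i) i).
Qed.

Lemma pivot_law_row_perm (s : {perm 'I_n}) S : <<s (@pivot_boxes R K n) >> S ->
  mu ((fun w => row_perm s (A w)) @^-1` S) = mu (A @^-1` S).
Proof.
apply: (@pivot_law_unique R K n _ T mu _ _ T mu) => //.
- move=> i j _; rewrite (_ : (fun w => _) = (fun w => A w (s i) j)).
    exact: random_entry.
  by apply/funext => w; rewrite mxE.
- by move=> i j _; exact: random_entry.
- by rewrite [X in (X < _)%E](@probability_setT _ T R mu) ltry.
- exact: pivot_box_law_row_perm.
Qed.

(* Replacing one entry by an independent copy does not change the law of the
   first n-1 columns, and makes Fubini applicable to that entry. *)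
Definition resample (a l : 'I_n) (ww : T * T) : 'M[F]_n :=
  A ww.1 + (A ww.2 a l - A ww.1 a l) *: delta_mx a l.

Lemma resampleE a l ww i j : resample a l ww i j =
  if (i == a) && (j == l) then A ww.2 i j else A ww.1 i j.
Proof.
rewrite !mxE; case: ifP => [/andP[/eqP -> /eqP ->]|_]; last by rewrite mulr0 addr0.
by rewrite mulr1 addrC subrK.
Qed.

Lemma random_resample a l i j : random_element borel (fun ww => resample a l ww i j).
Proof.
rewrite (_ : (fun ww => _) = (fun ww : T * T =>
    if (i == a) && (j == l) then A ww.2 i j else A ww.1 i j)).
  move=> S mS; case: (_ && _).
    rewrite -[X in measurable X]setTI.
    exact: (@measurable_snd _ _ T T measurableT _ (@random_entry i j _ mS)).
  rewrite -[X in measurable X]setTI.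
  exact: (@measurable_fst _ _ T T measurableT _ (@random_entry i j _ mS)).
by apply/funext => ww; rewrite resampleE.
Qed.

(** For a box the event is a rectangle: the first coordinate carries the constraints on all entries
    but [(a, l)], the second the constraint on that entry. Its measure is the same product as in
    [pivot_box_law]. *)
Lemma pivot_law_resample (a l : 'I_n) S : <<s (@pivot_boxes R K n) >> S ->
  (mu \x mu)%E (resample a l @^-1` S) = mu (A @^-1` S).
Proof.
apply: (@pivot_law_unique R K n _ _ (mu \x mu)%E _ _ T mu) => //.
- by move=> i j _; exact: random_resample.
- by move=> i j _; exact: random_entry.
- rewrite -setXTT [X in (X < _)%E]product_measure1E//.
  rewrite [X in (X * _)%E](@probability_setT _ T R mu) mul1e.
  by rewrite [X in (X < _)%E](@probability_setT _ T R mu) ltry.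
move=> U bU; have [mU UT] := bU.
pose V i j := if (i == a) && (j == l) then setT else U i j.
have bV : pivot_box V.
  split=> [i j|i j jn]; rewrite /V; case: ifP => // _; first exact: scalar_borelT.
  exact: UT.
have -> : resample a l @^-1` box U = (A @^-1` box V) `*` [set w | U a l (A w a l)].
  apply/seteqP; split=> [[w w'] h|[w w'] [/= h1 h2] i j].
    split=> [i j|]; last by have := h a l; rewrite resampleE !eqxx.
    by have := h i j; rewrite resampleE /V; case: ifP.
  have := h1 i j; rewrite resampleE /V; case: ifP => //.
  by move=> /andP[/eqP -> /eqP ->].
transitivity (mu (A @^-1` box V) * mu [set w | U a l (A w a l)])%E.
  apply: product_measure1E; last exact: (@random_entry a l _ (mU a l)).
  apply: measurable_pivot_sets => [i j _|]; first exact: random_entry.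
  by apply: sub_sigma_algebra; exists V.
apply: etrans (esym (pivot_box_law bU)).
rewrite pivot_box_law// (bigD1 (a, l))//= [RHS](bigD1 (a, l))//=.
rewrite [X in (X * _ * _)%E](_ : _ = 1%E) ?mul1e; last first.
  by rewrite /V !eqxx (_ : [set _ | _] = setT) ?probability_setT.
rewrite muleC; congr (_ * _)%E; apply: eq_bigr => -[i j]; rewrite xpair_eqE /V /=.
by move=> /negbTE ->.
Qed.

(** After resampling entry [(i, k)], Fubini fixes [w] and lets only that entry vary. By
    [plain_stage_shift] the variation reaches stage [k] as a translation of the same entry. *)
Lemma tie_null (k : 'I_n.-1) (i j : 'I_n) : (k <= i)%N -> (k <= j)%N -> i != j ->
  mu [set w | `|plain_stage (A w) k i (step_idx k)| ==
              `|plain_stage (A w) k j (step_idx k)|] = 0%E.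
Proof.
move=> ki kj ij.
have <- := pivot_law_resample i (step_idx k) (@tie_pivot_sets R K n k i j).
rewrite /product_measure1 integral0_eq// => w _ /=.
have stE w' : plain_stage (resample i (step_idx k) (w, w')) k =
    plain_stage (A w) k +
    (A w' i (step_idx k) - A w i (step_idx k)) *: delta_mx i (step_idx k).
  by rewrite /resample plain_stage_shift// ltnW.
(* [c] is the correction that the first [k] steps add to the entry, [r] the squared modulus of its
   rival; neither depends on [w']. *)
pose c := plain_stage (A w) k i (step_idx k) - A w i (step_idx k).
pose r := sqnorm (plain_stage (A w) k j (step_idx k)).
rewrite (_ : xsection _ _ =
    (fun w' => A w' i (step_idx k)) @^-1` [set x | sqnorm (x + c) = r]).
  have [mC nC] := sqnorm_circle c r.
  have [_ _ /(_ (step_idx k) (ltn_ord k))[_ _ /(_ i) acA]] := hA.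
  exact: acA.
have rsE w' : ((w, w') \in resample i (step_idx k) @^-1`
    [set M | `|plain_stage M k i (step_idx k)| == `|plain_stage M k j (step_idx k)|]) =
    (sqnorm (A w' i (step_idx k) + c) == r).
  have -> : (sqnorm (A w' i (step_idx k) + c) == r) =
      (`|plain_stage (resample i (step_idx k) (w, w')) k i (step_idx k)| ==
       `|plain_stage (resample i (step_idx k) (w, w')) k j (step_idx k)|).
    rewrite eqr_norm_sqnorm stE !mxE !eqxx (eq_sym j i) (negbTE ij) /= mulr0 addr0 mulr1.
    by rewrite addrCA.
  by apply/idP/idP => [/set_mem|h]; [|exact: mem_set].
by apply/seteqP; split=> w'; rewrite /xsection /= rsE => /eqP.
Qed.

(** The conditions on the indices are part of the event, so the exceptional set is a union over a
    whole finite type. *)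
Definition row_perm_tie (x : {perm 'I_n} * ('I_n.-1 * ('I_n * 'I_n))) : set T :=
  [set w | [&& (x.2.1 <= x.2.2.1)%N, (x.2.1 <= x.2.2.2)%N, x.2.2.1 != x.2.2.2 &
    `|plain_stage (row_perm x.1 (A w)) x.2.1 x.2.2.1 (step_idx x.2.1)| ==
    `|plain_stage (row_perm x.1 (A w)) x.2.1 x.2.2.2 (step_idx x.2.1)|]].

Lemma row_perm_tie_null x : measurable (row_perm_tie x) /\ mu (row_perm_tie x) = 0%E.
Proof.
case: x => s [k [i j]]; rewrite /row_perm_tie /=.
have [ki|] /= := leqP k i; last by rewrite (_ : [set _ | _] = set0)// -subset0.
have [kj|] /= := leqP k j; last by rewrite (_ : [set _ | _] = set0)// -subset0.
have [|ij] /= := eqVneq i j; first by rewrite (_ : [set _ | _] = set0)// -subset0.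
have tS := @tie_pivot_sets R K n k i j.
split; last by rewrite -(tie_null ki kj ij); exact: (pivot_law_row_perm s tS).
apply: (@measurable_pivot_sets R K n _ T (fun w => row_perm s (A w))) tS => i' j' _.
rewrite (_ : (fun w => _) = (fun w => A w (s i') j')); first exact: random_entry.
by apply/funext => w; rewrite mxE.
Qed.

Lemma measure_fin_bigcup_le (I : finType) (G : I -> set T) :
  (forall i, measurable (G i)) -> (mu (\bigcup_i G i) <= \sum_i mu (G i))%E.
Proof.
move=> mG.
suff H (r : seq I) : measurable [set w | exists2 i, i \in r & G i w] /\
    (mu [set w | exists2 i, i \in r & G i w] <= \sum_(i <- r) mu (G i))%E.
  have [_] := H (index_enum I); congr (mu _ <= _)%E.
  by apply/seteqP; split=> w [i _ Gi]; exists i => //; rewrite mem_index_enum.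
elim: r => [|i r [mr IH]].
  rewrite (_ : [set _ | _] = set0) ?measure0 ?big_nil//.
  by rewrite -subset0 => w [].
rewrite (_ : [set _ | _] = G i `|` [set w | exists2 i, i \in r & G i w]).
  split; first exact: measurableU.
  by rewrite big_cons (le_trans (measureU2 _ _ _))// leeD2l.
apply/seteqP; split=> w [].
  by move=> j; rewrite inE => /orP[/eqP ->|jr Gj]; [left|right; exists j].
  by move=> Gi; exists i => //; rewrite mem_head.
by move=> [j jr Gj]; exists j => //; rewrite inE jr orbT.
Qed.

Section IidGepp.
Variable pv : T -> {ffun 'I_n.-1 -> 'I_n}.
Hypothesis hpv : random_gepp_pivots A pv.

Lemma gepp_P_lower_bound (s : {perm 'I_n}) :
  (((n`!)%:R^-1)%:E <= mu ((fun w => gepp_P F (pv w)) @^-1` [set perm_mx s]))%E.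
Proof.
have [mpv gpv] := hpv.
pose H (r : {perm 'I_n}) := (fun w => row_perm r (A w)) @^-1` [set M | pivot_dominant M].
have mH r : measurable (H r).
  apply: (@measurable_pivot_sets R K n _ T (fun w => row_perm r (A w))).
    move=> i' j' _; rewrite (_ : (fun w => _) = (fun w => A w (r i') j')).
      exact: random_entry.
    by apply/funext => w; rewrite mxE.
  exact: pivot_dominant_pivot_sets.
have muH r : mu (H r) = mu (H s).
  by rewrite /H !pivot_law_row_perm//; exact: pivot_dominant_pivot_sets.
(* Away from ties, the permutation that GEPP itself produces makes all pivots dominant. *)
have cover : setT `<=` (\bigcup_r H r) `|` (\bigcup_x row_perm_tie x).
  move=> w _; have [h|/existsNP[x hx]] := pselect (forall x, ~ row_perm_tie x w); last first.
    by right; exists x => //; exact: contrapT.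
  left; exists (pivot_perm (pv w)) => //; apply: tie_free_dominant => // r k i j ki kj ij.
  apply/negP => tie; apply: (h (r, (k, (i, j)))).
  by rewrite /row_perm_tie /= ki kj ij.
have mB : measurable (\bigcup_r H r).
  by apply: fin_bigcup_measurable => //; exact: finite_finset.
have mC : measurable (\bigcup_x row_perm_tie x).
  apply: fin_bigcup_measurable => [|x _]; first exact: finite_finset.
  by case: (row_perm_tie_null x).
have le1 : (1 <= mu (H s) *+ n`!)%E.
  rewrite -(probability_setT mu).
  apply: le_trans (le_measure mu _ _ cover) _; rewrite ?inE//; first exact: measurableU.
  apply: le_trans (measureU2 _ _ _) _ => //.
  apply: (@le_trans _ _ (mu (\bigcup_r H r) + 0)%E).
    rewrite leeD2l//; apply: le_trans (measure_fin_bigcup_le _) _.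
      by move=> x; case: (row_perm_tie_null x).
    by rewrite big1// => x _; case: (row_perm_tie_null x).
  rewrite adde0; apply: le_trans (measure_fin_bigcup_le _) _ => //.
  rewrite (eq_bigr (fun=> mu (H s))) => [|r _]; last exact: muH.
  by rewrite sumr_const card_Sn.
apply: (@le_trans _ _ (mu (H s))).
  have fH : mu (H s) \is a fin_num by exact: fin_num_measure.
  move: le1; rewrite -(fineK fH) -EFin_natmul !lee_fin => le1.
  by rewrite -[leLHS]mul1r ler_pdivrMr ?ltr0n ?fact_gt0// mulr_natr.
(* On [H s], dominance forces GEPP to return [s], however ties are broken. *)
apply: le_measure; rewrite ?inE//; first exact: (mpv [set p | gepp_P F p = perm_mx s]).
by move=> w; rewrite /H /= => hs; rewrite gepp_PE (gepp_pivots_dominant (gpv w) hs).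
Qed.

Lemma iid_gepp_P_law :
  has_law mu (fun w => gepp_P F (pv w)) (uniform_on R (@perm_matrices F n)).
Proof.
have [mpv gpv] := hpv.
have -> : @perm_matrices F n = range (@perm_mx F n).
  apply/seteqP; split=> Q; first by move=> /is_perm_mxP[s ->]; exists s.
  by move=> [s _ <-]; exact: perm_mx_is_perm.
apply: has_law_uniform_on => //.
- by rewrite card_Sn fact_gt0.
- by move=> S _; exact: (mpv [set p | S (gepp_P F p)]).
- exact: perm_mx_inj.
- by move=> s; rewrite card_Sn; exact: gepp_P_lower_bound.
Qed.

(** By injectivity of [pivot_perm], the lower bound for each permutation is one for each admissible
    pivot sequence. There are n! of these, so [pv] is uniform on them, and [stirling1_lawE] counts
    those with given Pi. *)
Lemma iid_gepp_Pi_law : (1 <= n)%N ->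
  has_law mu (fun w => gepp_Pi (pv w))
    (image_law (fun u : nat => (n - u)%N) (@stirling1_law R n)).
Proof.
move=> n1 E; have [mpv gpv] := hpv.
have adm w : pv w \in admissible_set n.
  exact/admissible_setP/(gepp_pivots_admissible (gpv w)).
have lower p : p \in admissible_set n ->
    ((#|admissible_set n|%:R^-1)%:E <= mu (pv @^-1` [set p]))%E.
  move=> hp; rewrite (card_admissible_set R n1).
  apply: le_trans (gepp_P_lower_bound (pivot_perm p)) _.
  apply: le_measure; rewrite ?inE; [exact: (mpv [set q | gepp_P F q = _])|exact: mpv|].
  move=> w /=; rewrite gepp_PE => /perm_mx_inj pq; apply/ffunP.
  by apply: pivot_perm_inj => //; exact/admissible_setP.
rewrite stirling1_lawE// -(card_admissible_set R n1).
have c0 : (0 < #|admissible_set n|)%N by rewrite (card_admissible_set R n1) fact_gt0.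
rewrite (_ : _ @^-1` E = pv @^-1` [set p : {ffun _ -> _} | E (gepp_Pi p)])//.
rewrite (uniform_law_lower_bound c0 mpv (in2W (fun _ _ => id)) lower).
congr ((_%:R / _)%:E); apply: eq_card => p; rewrite !inE; congr (_ && _).
Qed.

End IidGepp.
End IidColumns.

(** * Butterfly matrices *)

Section Kronecker.
Context (F : numFieldType).

(** Quantifying [P] over all sizes lets the [castmx] in [kron] be removed once and for all, by
    eliminating the size equation. *)
Lemma kron_ind (P : forall n, 'M[F]_n -> Prop) (Q : 'M[F]_2 -> Prop) :
  P 1%N 1%:M ->
  (forall n (M : 'M[F]_2) (N : 'M[F]_n), Q M -> P n N -> P (2 * n)%N (M *t N)) ->
  forall m (M : 'I_m -> 'M[F]_2), (forall j, Q (M j)) -> P (2 ^ m)%N (kron M).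
Proof.
move=> P1 PS; elim=> [//|m IH] M QM /=.
have castP n n' (e : n = n') (N : 'M[F]_n) : P n N -> P n' (castmx (e, e) N).
  by case: n' / e => PN; rewrite castmx_id.
by apply: castP; apply: PS => //; apply: IH.
Qed.

Lemma kron_mulmx m (M N : 'I_m -> 'M[F]_2) :
  kron M *m kron N = kron (fun j => M j *m N j).
Proof.
elim: m M N => [|m IH] M N /=; first by rewrite mul1mx.
have castM n n' (e : n = n') (X Y : 'M[F]_n) :
    castmx (e, e) X *m castmx (e, e) Y = castmx (e, e) (X *m Y).
  by case: n' / e; rewrite !castmx_id.
by rewrite castM tensmx_mul IH.
Qed.

Lemma kron1 m : kron (fun _ : 'I_m => 1%:M) = 1%:M :> 'M[F]_(2 ^ m).
Proof.
apply: (@kron_ind (fun n (M : 'M[F]_n) => M = 1%:M) (fun M => M = 1%:M)) => //.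
move=> n M N -> ->; apply/matrixP => i j.
case: (mxtens_indexP i) => i1 i2; case: (mxtens_indexP j) => j1 j2.
rewrite tensmxE !mxE -natrM mulnb (can_eq (@mxtens_indexK _ _)).
by rewrite xpair_eqE.
Qed.

Lemma kron_diag0 m (M : 'I_m -> 'M[F]_2) j :
  (forall i, M j i i = 0) -> forall i, kron M i i = 0.
Proof.
elim: m M j => [|m IH] M j Mj i; first by case: j Mj.
rewrite /= castmxE mxE; have [jm|jm] := ltnP j m; last first.
  have -> : ord_max = j by apply/val_inj => /=; have := ltn_ord j; lia.
  by rewrite Mj mul0r.
rewrite (IH _ (Ordinal jm)) ?mulr0// => {}i.
by rewrite (_ : widen_ord _ _ = j)//; exact/val_inj.
Qed.

Lemma tensmx_is_perm n m (M : 'M[F]_n) (N : 'M[F]_m) :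
  is_perm_mx M -> is_perm_mx N -> is_perm_mx (M *t N).
Proof.
move=> /is_perm_mxP[s ->] /is_perm_mxP[r ->].
pose f (i : 'I_(n * m)) := mxtens_index (s (mxtens_unindex i).1, r (mxtens_unindex i).2).
have fI : injective f.
  move=> i j /(congr1 (@mxtens_unindex _ _)).
  rewrite !mxtens_indexK => -[/perm_inj ij1 /perm_inj ij2].
  by rewrite -[LHS]mxtens_unindexK -[RHS]mxtens_unindexK /mxtens_unindex ij1 ij2.
apply/is_perm_mxP; exists (perm fI); apply/matrixP => i j.
case: (mxtens_indexP i) => i1 i2; case: (mxtens_indexP j) => j1 j2.
rewrite tensmxE !mxE permE /f mxtens_indexK /= -natrM mulnb.
congr (_%:R : F); congr nat_of_bool.
by rewrite (can_eq (@mxtens_indexK _ _)) xpair_eqE.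
Qed.

Definition swap_if (b : bool) : 'M[F]_2 := if b then tperm_mx ord0 ord_max else 1%:M.

Lemma swap_ifM b c : swap_if b *m swap_if c = swap_if (b (+) c).
Proof.
rewrite /swap_if; case: b c => -[]; rewrite ?mul1mx ?mulmx1//.
by rewrite -perm_mxM tperm2 perm_mx1.
Qed.

Lemma kron_swap_is_perm m (e : 'I_m -> bool) : is_perm_mx (kron (fun j => swap_if (e j))).
Proof.
apply: (@kron_ind (fun n (M : 'M[F]_n) => is_perm_mx M : Prop)
  (fun M => is_perm_mx M : Prop) _ _ m (fun j => swap_if (e j))).
- exact: is_perm_mx1.
- by move=> n M N; exact: tensmx_is_perm.
- by move=> j; rewrite /swap_if; case: (e j); rewrite ?perm_mx_is_perm ?is_perm_mx1.
Qed.

Lemma kron_swapK m (e : 'I_m -> bool) :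
  kron (fun j => swap_if (e j)) *m kron (fun j => swap_if (e j)) = 1%:M.
Proof.
rewrite kron_mulmx -(kron1 m); congr kron; apply/funext => j.
by rewrite swap_ifM addbb.
Qed.

Lemma kron_swap_diag0 m (e : 'I_m -> bool) j : e j ->
  forall i, kron (fun j => swap_if (e j)) i i = 0.
Proof.
move=> ej; apply: (@kron_diag0 _ _ j) => i; rewrite ej !mxE.
by case: tpermP => [->|->|/eqP i0 /eqP i1] //; case: i i0 i1 => -[|[|]].
Qed.

(** If the matrices agree, their product is the identity by [kron_swapK]. It is also the swap matrix
    of the bits [e j (+) f j], whose diagonal vanishes as soon as one bit is set. *)
Lemma kron_swap_inj m (e f : 'I_m -> bool) :
  kron (fun j => swap_if (e j)) = kron (fun j => swap_if (f j)) -> e =1 f.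
Proof.
move=> ef j; apply/eqP; apply: contraT => nef.
have := kron_swapK e; rewrite {2}ef kron_mulmx.
rewrite (_ : (fun j => _) = (fun j => swap_if (e j (+) f j))); last first.
  by apply/funext => i; rewrite swap_ifM.
have efj : e j (+) f j by move: nef; case: (e j) (f j) => -[].
have i0 : (0 < 2 ^ m)%N by rewrite expn_gt0.
move=> /matrixP/(_ (Ordinal i0) (Ordinal i0)).
rewrite (@kron_swap_diag0 _ (fun j => e j (+) f j) j)// !mxE eqxx => /eqP.
by rewrite eq_sym oner_eq0.
Qed.

Definition has_dominant_LU n (M : 'M[F]_n) : Prop :=
  exists L U, [/\ unit_lower_lt1 L, upper_nonzero_diag U & M = L *m U].

(** The index of a pair is [i1 * m + i2], which orders pairs lexicographically. *)
Lemma mxtens_index_lt n m (i1 j1 : 'I_n) (i2 j2 : 'I_m) :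
  (mxtens_index (i1, i2) < mxtens_index (j1, j2))%N ->
  (i1 < j1)%N \/ i1 = j1 /\ (i2 < j2)%N.
Proof.
have [ij _|lt h|/val_inj ->] /= := ltngtP i1 j1; [by left| |].
  exfalso; have := leq_mul lt (leqnn m); rewrite mulSn.
  by move: h => /=; have := ltn_ord j2; lia.
by move=> h; right; split=> //; move: h; rewrite ltn_add2l.
Qed.

(** By the mixed-product rule the factors multiply separately. Below the diagonal, an entry of
    [L1 *t L2] has one factor of modulus less than 1 and another of modulus at most 1. *)
Lemma tensmx_dominant_LU n m (M : 'M[F]_n) (N : 'M[F]_m) :
  has_dominant_LU M -> has_dominant_LU N -> has_dominant_LU (M *t N).
Proof.
move=> [L1 [U1 [[L1d L1u L1l] [U1l U1d] ->]]] [L2 [U2 [[L2d L2u L2l] [U2l U2d] ->]]].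
have le1 p (L : 'M[F]_p) : (forall i, L i i = 1) ->
    (forall i j : 'I_p, (i < j)%N -> L i j = 0) ->
    (forall i j : 'I_p, (j < i)%N -> `|L i j| < 1) -> forall i j, `|L i j| <= 1.
  move=> Ld Lu Ll i j; have [/Lu ->|/Ll/ltW//|/val_inj ->] := ltngtP i j.
    by rewrite normr0.
  by rewrite Ld normr1.
exists (L1 *t L2), (U1 *t U2); split; last by rewrite tensmx_mul.
  split=> [i|i j|i j].
  - by case: (mxtens_indexP i) => i1 i2; rewrite tensmxE L1d L2d mulr1.
  - case: (mxtens_indexP i) => i1 i2; case: (mxtens_indexP j) => j1 j2.
    move=> /mxtens_index_lt[ij|[-> ij]]; rewrite tensmxE; first by rewrite L1u ?mul0r.
    by rewrite L2u ?mulr0.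
  - case: (mxtens_indexP i) => i1 i2; case: (mxtens_indexP j) => j1 j2.
    move=> /mxtens_index_lt[ij|[-> ij]]; rewrite tensmxE normrM; last first.
      by rewrite L1d normr1 mul1r L2l.
    apply: (@le_lt_trans _ _ (`|L1 i1 j1| * 1)); last by rewrite mulr1 L1l.
    by rewrite ler_wpM2l// le1.
split=> [i j|i].
  case: (mxtens_indexP i) => i1 i2; case: (mxtens_indexP j) => j1 j2.
  move=> /mxtens_index_lt[ij|[-> ij]]; rewrite tensmxE; first by rewrite U1l ?mul0r.
  by rewrite U2l ?mulr0.
by case: (mxtens_indexP i) => i1 i2; rewrite tensmxE mulf_neq0.
Qed.

Lemma kron_dominant m (M : 'I_m -> 'M[F]_2) :
  (forall j, has_dominant_LU (M j)) -> pivot_dominant (kron M).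
Proof.
move=> hM.
have [||L [U [hL hU ->]]] := @kron_ind has_dominant_LU (@has_dominant_LU 2) _ _ m M hM;
  last exact: pivot_dominant_LU.
  exists 1%:M, 1%:M; split; last by rewrite mulmx1.
    by split=> [i|i j|i j]; rewrite ?(ord1 i) ?(ord1 j) ?ltnn// mxE.
  by split=> [i j|i]; rewrite ?(ord1 i) ?(ord1 j) ?ltnn// mxE oner_eq0.
by move=> n A N; exact: tensmx_dominant_LU.
Qed.

(** One elimination step gives the factors; the second pivot is the determinant divided by the
    first. *)
Lemma dominant_LU2 (M : 'M[F]_2) : `|M ord_max ord0| < `|M ord0 ord0| ->
  M ord0 ord0 * M ord_max ord_max - M ord_max ord0 * M ord0 ord_max != 0 ->
  has_dominant_LU M.
Proof.
move=> lt01 det0; set a := M ord0 ord0 in lt01 det0.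
have a0 : a != 0 by rewrite -normr_gt0 (le_lt_trans _ lt01).
have ordE (i : 'I_2) : i = ord0 \/ i = ord_max.
  by case: i => -[|[|//]] h; [left|right]; exact/val_inj.
exists (\matrix_(i, j) (if i == j then 1 else if (j < i)%N then M i j / a else 0)).
exists (\matrix_(i, j) (if i == ord0 then M i j else if j == ord0 then 0 else
  M ord_max ord_max - M ord_max ord0 / a * M ord0 ord_max)).
split.
- split=> [i|i j|i j].
  + by rewrite mxE eqxx.
  + by case: (ordE i) => ->; case: (ordE j) => ->; rewrite mxE.
  + case: (ordE i) => ->; case: (ordE j) => -> //; rewrite mxE /= => _.
    by rewrite normrM normfV ltr_pdivrMr ?normr_gt0// mul1r.
- split=> [i j|i].
  + by case: (ordE i) => ->; case: (ordE j) => -> //; rewrite mxE.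
  + case: (ordE i) => ->; rewrite mxE //=.
    apply: contraNneq det0 => h; apply/eqP.
    rewrite -[RHS](mulr0 a) -h mulrBr; congr (_ - _).
    by rewrite -/a; field.
apply/matrixP => i j; rewrite mxE !big_ord_recl big_ord0 addr0 !mxE /=.
by case: (ordE i) => ->; case: (ordE j) => -> /=; rewrite ?mxE /= -/a; field.
Qed.

End Kronecker.

(** The cycles are the pairs of [i] and [s i], which partition the indices into blocks of size 2. *)
Lemma card_porbits_involution (n : nat) (s : {perm 'I_n}) :
  (s * s = 1)%g -> (forall i, s i != i) -> (#|porbits s| * 2 = n)%N.
Proof.
move=> ss fs.
have sK i : s (s i) = i by rewrite -permM ss perm1.
have orbE i : porbit s i = [set i; s i]%SET.
  apply/setP => j; rewrite !inE; apply/porbitP/orP => [[u ->]|[/eqP ->|/eqP ->]].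
  - elim: u => [|u IH]; first by rewrite expg0 perm1 eqxx; left.
    rewrite expgSr permM; case: IH => /eqP ->; [right|left]; by rewrite ?sK.
  - by exists 0%N; rewrite perm1.
  - by exists 1%N; rewrite expg1.
have part : finset.partition (porbits s) [set: 'I_n]%SET.
  apply/and3P; split.
  - apply/eqP/setP => i; rewrite inE; apply/finset.bigcupP.
    by exists (porbit s i); [exact: imset_f|exact: porbit_id].
  - apply/finset.trivIsetP => _ _ /imsetP[i _ ->] /imsetP[j _ ->].
    apply: contraR => /pred0Pn[k /andP[/= ki kj]].
    by rewrite -eq_porbit_mem in ki; rewrite -eq_porbit_mem in kj; rewrite -(eqP ki) (eqP kj).
  - by apply/imsetP => -[i _ /setP/(_ i)]; rewrite porbit_id inE.
have := card_uniform_partition (n := 2%N) _ part.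
rewrite cardsT card_ord => <- // _ /imsetP[i _ ->].
by rewrite orbE cards2 eq_sym fs.
Qed.

Lemma measurable_cos (R : realType) : measurable_fun setT (@cos R).
Proof. by apply: continuous_measurable_fun; exact: continuous_cos. Qed.

Lemma measurable_sin (R : realType) : measurable_fun setT (@sin R).
Proof. by apply: continuous_measurable_fun; exact: continuous_sin. Qed.

(** * Sine against cosine for a uniform angle *)

Section Angles.
Context (R : realType).

Definition dominant_angles (b : bool) : set (measurableTypeR R) :=
  [set x | if b then `|cos x| < `|sin x| else `|sin x| < `|cos x|].

(** The sign of cos 2x = cos^2 x - sin^2 x decides which modulus is larger. *)
Lemma dominant_anglesE b x : dominant_angles b x <->
  0 < (-1) ^+ b * cos (x *+ 2).
Proof.
have lt2 (y z : R) : (`|y| < `|z|) = (y ^+ 2 < z ^+ 2).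
  by rewrite -ltr_sqr ?nnegrE// !real_normK// num_real.
rewrite /dominant_angles /= cos_mulr2n -mulr_natl; have := cos2Dsin2 x => h.
by case: b; rewrite lt2 ?expr0 ?expr1; split; lra.
Qed.

Lemma measurable_dominant_angles b : measurable (dominant_angles b).
Proof.
have mc := @measurable_cos R; have ms := @measurable_sin R.
have mnc : measurable_fun setT (fun x : R => `|cos x|) by exact: measurableT_comp.
have mns : measurable_fun setT (fun x : R => `|sin x|) by exact: measurableT_comp.
rewrite -[X in measurable X]setTI /dominant_angles.
by case: b; exact: measurable_fun_ltr.
Qed.

Lemma uniform_prob_octants (p q : nat) : (p < q)%N -> (q <= 8)%N ->
  uniform_prob (@two_pi_gt0 R) `]p%:R * (pi / 4), q%:R * (pi / 4)[%classic =
  ((q - p)%N%:R / 8)%:E.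
Proof.
move=> pq q8; have pi0 := pi_gt0 R.
rewrite /uniform_prob (eq_integral (fun=> ((2 * pi - 0)^-1 : R)%:E)); last first.
  move=> x; rewrite inE /= in_itv /= /uniform_pdf => /andP[px xq].
  rewrite ifT//; apply/andP; split.
    by apply/ltW/(le_lt_trans _ px); rewrite mulr_ge0// divr_ge0// ltW.
  apply/ltW/(lt_le_trans xq); apply: (@le_trans _ _ (8%:R * (pi / 4))).
    by rewrite ler_wpM2r ?ler_nat// divr_ge0// ltW.
  lra.
rewrite integral_cst//= lebesgue_measure_itv /= lte_fin.
rewrite ltr_pM2r ?ltr_nat ?pq ?divr_gt0//.
rewrite -EFinD -EFinM natrB ?(ltnW pq)//; congr EFin.
have pin0 : pi != 0 :> R by rewrite gt_eqF.
by rewrite subr0; move: pin0; generalize (@pi R) => c c0; field.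
Qed.

(** The interval lies within pi/4 of n pi/2, so 2x is within pi/2 of n pi and cos 2x has the sign of
    (-1)^n. Writing [p.+1] instead of subtracting 1 from [n.*2] keeps n = 0 correct. *)
Lemma octants_dominant (n p q : nat) : (n.*2 <= p.+1)%N -> (q <= n.*2.+1)%N ->
  `]p%:R * (pi / 4), q%:R * (pi / 4)[%classic `<=` dominant_angles (odd n).
Proof.
move=> np qn x; rewrite /= in_itv /= => /andP[px xq]; apply/dominant_anglesE.
have pi0 := pi_gt0 R.
have hp : n%:R * 2 - 1 <= p%:R :> R.
  by move: np; rewrite -(ler_nat R) -natr1 -muln2 natrM lerBlDr.
have hq : q%:R <= n%:R * 2 + 1 :> R.
  by move: qn; rewrite -(ler_nat R) -natr1 -muln2 natrM.
have -> : x *+ 2 = (x *+ 2 - pi *+ n) + pi *+ n by rewrite subrK.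
rewrite (alternatingn (@cosDpi R)) signr_odd signrMK; apply: cos_gt0_pihalf.
rewrite -[x *+ 2]mulr_natr -[pi *+ n]mulr_natr.
have pi4 : 0 <= pi / 4 :> R by rewrite divr_ge0// ltW.
have h1 := ler_wpM2r pi4 hp; have h2 := ler_wpM2r pi4 hq.
by apply/andP; split; lra.
Qed.

Lemma uniform_prob_dominant_angles b :
  ((2^-1 : R)%:E <= uniform_prob (@two_pi_gt0 R) (dominant_angles b))%E.
Proof.
pose J (p q : nat) : set (measurableTypeR R) := `]p%:R * (pi / 4), q%:R * (pi / 4)[%classic.
have mJ p q : measurable (J p q) by exact: measurable_itv.
have dJ p q p' q' : (q <= p')%N -> J p q `&` J p' q' = set0.
  move=> qp; apply/seteqP; split=> // x []; rewrite /J /= !in_itv /= => /andP[_ xq] /andP[px _].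
  have := lt_trans px xq.
  by rewrite ltr_pM2r ?divr_gt0 ?pi_gt0// ltr_nat ltnNge qp.
pose P := uniform_prob (@two_pi_gt0 R).
have PU (X Y : set (measurableTypeR R)) : measurable X -> measurable Y ->
  X `&` Y = set0 -> P (X `|` Y) = (P X + P Y)%E by exact: measureU.
have PJ p q : (p < q)%N -> (q <= 8)%N -> P (J p q) = ((q - p)%N%:R / 8)%:E.
  exact: uniform_prob_octants.
case: b.
  (* Sine dominates around pi/2 and 3 pi/2: four octants of eight. *)
  apply: (@le_trans _ _ (P (J 1 3 `|` J 5 7))).
    rewrite PU//; last exact: dJ.
    by rewrite !PJ// -EFinD lee_fin !subSS !subn0; lra.
  apply: le_measure; rewrite ?inE//; [exact: measurableU|exact: measurable_dominant_angles|].
  by move=> x [|]; [exact: (@octants_dominant 1)|exact: (@octants_dominant 3)].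
(* Cosine dominates around 0, pi and 2 pi: again four octants, the ones at the two ends being halves
   of intervals cut by the range of the angle. *)
apply: (@le_trans _ _ (P (J 0 1 `|` J 3 5 `|` J 7 8))).
  rewrite PU//; last 2 first.
  - exact: measurableU.
  - by rewrite setIUl !dJ// setU0.
  rewrite PU//; last exact: dJ.
  by rewrite !PJ// -!EFinD lee_fin !subSS !subn0; lra.
apply: le_measure; rewrite ?inE//; [|exact: measurable_dominant_angles|].
  by apply: measurableU => //; exact: measurableU.
by move=> x [[|]|]; [exact: (@octants_dominant 0)|exact: (@octants_dominant 2)|
  exact: (@octants_dominant 4)].
Qed.

End Angles.

(** * GEPP on Haar-butterfly matrices *)

Section ButterflyLaws.
Context (R : realType).

(** The swap brings the larger entry of the first column to the top, and the determinant is 1 or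
    -1. *)
Lemma swap_rotation_dominant_LU b (t : R) : dominant_angles b t ->
  has_dominant_LU (swap_if R b *m rotation t).
Proof.
have cs := cos2Dsin2 t; rewrite /dominant_angles /= /swap_if.
have tpE i j : (tperm_mx ord0 ord_max *m rotation t) i j =
    rotation t (tperm ord0 ord_max i) j by rewrite -row_permE mxE.
case: b => lt; apply: dominant_LU2; rewrite ?mul1mx ?tpE ?tpermL ?tpermR !mxE /= ?normrN//.
  by apply/negP => /eqP; lra.
by apply/negP => /eqP; lra.
Qed.

Lemma random_kron d (T : measurableType d) m (M : 'I_m -> T -> 'M[R]_2) :
  (forall j i i', measurable_fun setT (fun w => M j w i i')) ->
  forall i i', measurable_fun setT (fun w => kron (fun j => M j w) i i').
Proof.
elim: m M => [|m IH] M mM i i' /=; first exact: measurable_cst.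
under eq_fun do rewrite castmxE mxE.
by apply: measurable_funM; [exact: mM|apply: IH => j *; exact: mM].
Qed.

Lemma random_butterfly d (T : measurableType d) m (theta : 'I_m -> T -> R) :
  (forall j, measurable_fun setT (theta j)) ->
  forall i i', measurable_fun setT (fun w => butterfly (theta ^~ w) i i').
Proof.
move=> mt; apply: (@random_kron _ T m (fun j w => rotation (theta j w))) => j i i'.
have mc := @measurable_cos R; have ms := @measurable_sin R.
under eq_fun do rewrite mxE.
case: (i == i'); first exact: measurableT_comp.
case: (i < i')%N; first exact: measurableT_comp.
by apply: measurable_funN; exact: measurableT_comp.
Qed.

Context d (T : measurableType d) (mu : probability T R) (m : nat).
Context (B : T -> 'M[R]_(2 ^ m)) (pv : T -> {ffun 'I_(2 ^ m).-1 -> 'I_(2 ^ m)}).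
Hypothesis hB : haar_butterfly mu B.
Hypothesis hpv : random_gepp_pivots B pv.

Lemma butterfly_P_lower_bound (e : 'I_m -> bool) :
  (((2 ^ m)%N%:R^-1)%:E <=
   mu ((fun w => gepp_P R (pv w)) @^-1` [set kron (fun j => swap_if R (e j))]))%E.
Proof.
have [mpv gpv] := hpv; have [mB [d' [T' [mu' [theta [mt it ut eqB]]]]]] := hB.
have [s sE] := is_perm_mxP _ (kron_swap_is_perm R e).
pose S := [set M : 'M[R]_(2 ^ m) | pivot_dominant (row_perm s M)].
have dS := @pivot_dominant_pivot_sets R RealScalars (2 ^ m).
(* The laws of [B] and of the butterfly matrix of the angles are compared on [mx_borel] only, so the
   dominance event has to be placed there before it moves to the space of the angles. *)
have mS : mx_borel (@scalar_borel R RealScalars) S.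
  rewrite /mx_borel.
  apply: (@measurable_pivot_sets R RealScalars (2 ^ m) _ (g_sigma_algebraType
    [set S | exists i j, exists2 U, (@scalar_borel R RealScalars) U &
       S = [set M : 'M[R]_(2 ^ m) | U (M i j)]]) (fun M => row_perm s M) _ _ dS) => i j _ U mU.
  apply: sub_sigma_algebra; exists (s i), j, U => //.
  by apply/seteqP; split=> M; rewrite /= mxE.
have mS' : measurable ((fun w => butterfly (theta ^~ w)) @^-1` S).
  apply: (@measurable_pivot_sets R RealScalars (2 ^ m) _ T'
    (fun w => row_perm s (butterfly (theta ^~ w))) _ _ dS) => i j _.
  apply/random_element_real; under eq_fun do rewrite mxE.
  by apply: random_butterfly => k; apply/random_element_real; exact: mt.
apply: (@le_trans _ _ (mu (B @^-1` S))); last first.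
  apply: le_measure; rewrite ?inE; [exact: mB|exact: (mpv [set p | gepp_P R p = _])|].
  by move=> w hs /=; rewrite gepp_PE sE (gepp_pivots_dominant (gpv w) hs).
rewrite eqB//.
pose D := \bigcap_j (theta j @^-1` dominant_angles (e j)).
have mD : measurable D.
  apply: fin_bigcap_measurable => [|j _]; first exact: finite_finset.
  by apply: mt; exact: measurable_dominant_angles.
apply: (@le_trans _ _ (mu' D)); last first.
  apply: le_measure; rewrite ?inE// => w Dw; rewrite /S /=.
  rewrite row_permE -sE /butterfly kron_mulmx; apply: kron_dominant => j.
  by apply: swap_rotation_dominant_LU; exact: Dw.
rewrite /D it; last by move=> j; exact: measurable_dominant_angles.
rewrite (eq_bigr (fun j => uniform_prob (@two_pi_gt0 R) (dominant_angles (e j)))); last first.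
  by move=> j _; rewrite ut//; exact: measurable_dominant_angles.
rewrite natrX -exprVn -[X in _ ^+ X](card_ord m) -prodr_const.
(* Nonnegativity is carried along because multiplying the inequalities requires it. *)
suff : 0 <= \prod_(j < m) (2^-1 : R) /\ ((\prod_(j < m) (2^-1 : R))%:E <=
  \prod_(j < m) uniform_prob (@two_pi_gt0 R) (dominant_angles (e j)))%E by case.
elim/big_rec2 : _ => // j x y _ [y0 yx]; split; first by rewrite mulr_ge0// invr_ge0.
rewrite EFinM; apply: lee_pmul; rewrite ?lee_fin ?invr_ge0//.
exact: uniform_prob_dominant_angles.
Qed.

Let bits_P (e : {ffun 'I_m -> bool}) : 'M[R]_(2 ^ m) := kron (fun j => swap_if R (e j)).

Let bits_P_inj : injective bits_P.
Proof. by move=> e f /kron_swap_inj ef; apply/ffunP. Qed.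

Let card_bits : #|{ffun 'I_m -> bool}| = (2 ^ m)%N.
Proof. by rewrite card_ffun card_bool card_ord. Qed.

Lemma butterfly_P_law :
  has_law mu (fun w => gepp_P R (pv w)) (uniform_on R (@butterfly_perm_matrices R m)).
Proof.
have [mpv gpv] := hpv.
have -> : @butterfly_perm_matrices R m = range bits_P.
  apply/seteqP; split=> Q; last by move=> [e _ <-]; exists e.
  move=> [e ->]; exists (finfun e) => //; rewrite /bits_P.
  by congr kron; apply/funext => j; rewrite ffunE.
apply: has_law_uniform_on => //.
- by rewrite card_bits expn_gt0.
- by move=> S _; exact: (mpv [set p | S (gepp_P R p)]).
- by move=> e; rewrite card_bits; exact: butterfly_P_lower_bound.
Qed.

Lemma card_porbits_butterfly (s : {perm 'I_(2 ^ m)}) (e : {ffun 'I_m -> bool}) :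
  perm_mx s = bits_P e ->
  (2 ^ m - #|porbits s| = 2 ^ m %/ 2 * (e != [ffun=> false]))%N.
Proof.
move=> se; have [e0|] /= := eqVneq e [ffun=> false].
  have -> : s = 1%g.
    apply: (@perm_mx_inj R); rewrite se perm_mx1 -(kron1 R m) /bits_P e0.
    by congr kron; apply/funext => j; rewrite ffunE.
  by rewrite card_porbits1 subnn muln0.
move=> e0; have [j ej] : exists j, e j.
  apply/existsP; apply: contraNT e0 => /existsPn ne; apply/eqP/ffunP => j.
  by rewrite ffunE; apply/negbTE/ne.
have ss : (s * s = 1)%g.
  by apply: (@perm_mx_inj R); rewrite perm_mxM se kron_swapK perm_mx1.
have fs i : s i != i.
  have := kron_swap_diag0 R ej i; rewrite -/(bits_P e) -se !mxE => /eqP.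
  by rewrite pnatr_eq0 eqb0.
have h := card_porbits_involution ss fs; rewrite muln1.
have <- : #|porbits s| = (2 ^ m %/ 2)%N.
  by have := congr1 (divn^~ 2) h; rewrite /= mulnK.
by rewrite -[X in (X - _)%N]h muln2 -addnn addnK.
Qed.

Lemma butterfly_Pi_law : has_law mu (fun w => gepp_Pi (pv w))
  (image_law (fun b : bool => (2 ^ m %/ 2 * b)%N)
    (bernoulli_prob (1 - ((2 ^ m)%N%:R)^-1 : R))).
Proof.
have [mpv gpv] := hpv => E.
have adm w := gepp_pivots_admissible (gpv w).
have mP : random_element setT (fun w => gepp_P R (pv w)).
  by move=> S _; exact: (mpv [set p | S (gepp_P R p)]).
have c0 : (0 < #|[set: {ffun 'I_m -> bool}]%SET|)%N by rewrite cardsT card_bits expn_gt0.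
have lower e : e \in [set: {ffun 'I_m -> bool}]%SET ->
    ((#|[set: {ffun 'I_m -> bool}]%SET|%:R^-1)%:E <=
     mu ((fun w => gepp_P R (pv w)) @^-1` [set bits_P e]))%E.
  by move=> _; rewrite cardsT card_bits; exact: butterfly_P_lower_bound.
(* Pi is a function of P, namely N minus its number of cycles, so an event on Pi is an event [V] on
   P. *)
pose V := [set Q : 'M[R]_(2 ^ m) | exists2 s, Q = perm_mx s & E (2 ^ m - #|porbits s|)%N].
have -> : (fun w => gepp_Pi (pv w)) @^-1` E = (fun w => gepp_P R (pv w)) @^-1` V.
  have PiE w : gepp_Pi (pv w) = (2 ^ m - #|porbits (pivot_perm (pv w))|)%N.
    by rewrite -[X in (X - _)%N](card_porbits_pivot_perm (adm w)) addKn.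
  apply/seteqP; split=> w /=; first by rewrite PiE gepp_PE => Ew; exists (pivot_perm (pv w)).
  by rewrite PiE gepp_PE => -[s /perm_mx_inj ->].
rewrite (uniform_law_lower_bound c0 mP (in2W bits_P_inj) lower) cardsT card_bits.
pose f (b : bool) := (2 ^ m %/ 2 * b)%N.
have VE (e : {ffun 'I_m -> bool}) : (bits_P e \in V) = (f (e != [ffun=> false]) \in E).
  apply/idP/idP => /set_mem; last first.
    have [s sE] := is_perm_mxP _ (kron_swap_is_perm R e).
    by move=> h; apply/mem_set; exists s; rewrite ?(card_porbits_butterfly (esym sE)).
  by move=> [s /esym/card_porbits_butterfly ->] h; exact/mem_set.
(* The zero bit vector gives no movement, each of the N - 1 others gives N/2 of them. *)
have -> : #|[set e in [set: {ffun 'I_m -> bool}]%SET | bits_P e \in V]%SET| =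
    ((f false \in E) + (2 ^ m).-1 * (f true \in E))%N.
  rewrite -sum1_card big_mkcond /= (bigD1 [ffun=> false])//=.
  rewrite (eq_bigr (fun=> nat_of_bool (f true \in E))).
    rewrite sum_nat_const cardC1 card_bits; congr (_ + _)%N.
    by rewrite !inE VE eqxx; case: (_ \in _).
  by move=> e e0; rewrite !inE VE e0; case: (_ \in _).
have N0 : 0 < (2 ^ m)%N%:R :> R by rewrite ltr0n expn_gt0.
rewrite /image_law bernoulli_probE; last first.
  rewrite subr_ge0 invf_le1// ler1n expn_gt0 /= lerBlDr lerDl invr_ge0; exact: ltW.
rewrite !diracE -!EFinM -EFinD; congr EFin.
rewrite -[true \in _]/(f true \in E) -[false \in _]/(f false \in E) /unstable.onem.
rewrite natrD natrM -subn1 natrB ?expn_gt0//.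
move: N0; generalize ((2 ^ m)%N%:R : R) => N N0; field.
by rewrite gt_eqF.
Qed.

End ButterflyLaws.

Theorem theorem1 (R : realType) (d : measure_display) (T : measurableType d)
    (mu : probability T R) :
  (forall (K : scalar_kind) (n : nat) (A : T -> 'M[scalar R K]_n)
      (pv : T -> {ffun 'I_n.-1 -> 'I_n}),
    (2 <= n)%N ->
    iid_continuous_columns mu A ->
    random_gepp_pivots A pv ->
    has_law mu (fun w => gepp_P (scalar R K) (pv w))
      (uniform_on R (@perm_matrices (scalar R K) n)) /\
    has_law mu (fun w => gepp_Pi (pv w))
      (image_law (fun u : nat => (n - u)%N) (@stirling1_law R n)))
  /\
  (forall (m : nat) (B : T -> 'M[R]_(2 ^ m))
      (pv : T -> {ffun 'I_(2 ^ m).-1 -> 'I_(2 ^ m)}),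
    (1 <= m)%N ->
    haar_butterfly mu B ->
    random_gepp_pivots B pv ->
    has_law mu (fun w => gepp_P R (pv w))
      (uniform_on R (@butterfly_perm_matrices R m)) /\
    has_law mu (fun w => gepp_Pi (pv w))
      (image_law (fun b : bool => (2 ^ m %/ 2 * b)%N)
        (bernoulli_prob (1 - ((2 ^ m)%N%:R)^-1 : R)))).
Proof.
split=> [K n A pv n2 hA hpv|m B pv _ hB hpv].
  by split; [exact: iid_gepp_P_law hA _ hpv|exact: iid_gepp_Pi_law hA _ hpv (ltnW n2)].
by split; [exact: butterfly_P_law hB hpv|exact: butterfly_Pi_law hB hpv].
Qed.
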